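(* Let $G$ be a finitely presented group. (1) If $H_1(G,\mathbb{Z})\neq 0$, then $d(G^n)=\Theta(n)$ and $\rho(G^n)=\Theta(n^2)$. (2) If $H_1(G,\mathbb{Z})=0$ and $H_2(G,\mathbb{Z})\neq 0$, then $d(G^n)=O(\log n)$ and $\rho(G^n)=\Theta(n)$. (3) If $H_1(G,\mathbb{Z})=H_2(G,\mathbb{Z})=0$, then $d(G^n)=O(\log n)$ and $\rho(G^n)=O((\log n)^3)$. (4) If $H_1(G,\mathbb{Z})=H_2(G,\mathbb{Z})=0$ and $G$ has a non-trivial finite quotient, then $d(G^n)=\Theta(\log n)$ and there are positive constants $c_0,c_1$ such that $c_0\log n\le \rho(G^n)\le c_1(\log n)^3$ for all sufficiently large $n$. (5) If $H_1(G,\mathbb{Z})=H_2(G,\mathbb{Z})=0$ and there is an element $g\in G$ whose image has infinite order in every non-trivial quotient of $G$, then $d(G^n)\le d(G)+1$ for all $n$, and $\rho(G^n)=O(\log n)$. Moreover, in each of the cases (1)-(5), the upper bounds on $d(G^n)$ and $\rho(G^n)$ can be satisfied simultaneously, i.e. there are finite presentations of the groups $G^n$ in which the number of generators satisfies the stated upper bound for $d(G^n)$ and the number of relators satisfies the stated upper bound for $\rho(G^n)$.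
   Context: $G^n$ denotes the direct product of $n$ copies of $G$. For a finitely generated group $\Gamma$, $d(\Gamma)$ is the minimal number of generators of $\Gamma$. For a finitely presented group $\Gamma$, $\rho(\Gamma)$ is the minimum number of relators in any finite presentation of $\Gamma$. The estimates are asymptotic in $n\to\infty$ with $G$ fixed (the implied constants may depend on $G$): $f(n)=O(g(n))$ means that $f(n)$ is at most a positive constant multiple of $g(n)$ for all sufficiently large $n$, and $f(n)=\Theta(g(n))$ means that $f(n)$ is bounded above and below by positive constant multiples of $g(n)$ for all sufficiently large $n$. *)

(* Defs.v *)
From HB Require Import structures.
From mathcomp Require Import all_boot all_order all_algebra all_fingroup.
From mathcomp Require Import all_classical all_reals all_analysis.
From mathcomp Require Import freeg.

Set Implicit Arguments.
Unset Strict Implicit.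
Unset Printing Implicit Defensive.

Import Order.TTheory GRing.Theory Num.Theory.

Local Open Scope classical_set_scope.

(* The group structure on finite functions is the pointwise one. *)
Notation power G n := {ffun 'I_n -> G} (only parsing).

(* A letter (i, false) is the generator x_i, a letter (i, true) its inverse. *)
Definition word (k : nat) : Type := seq ('I_k * bool).

Definition word_eval (G : groupType) (k : nat) (a : 'I_k -> G) (w : word k) : G :=
  (\prod_(l <- w) (if l.2 then (a l.1)^-1 else a l.1))%g.

(* The group < x_0, ..., x_(k-1) | rels > is the set of words modulo this
   congruence: it is generated by the free reductions and by r ~ 1 for every
   relator r, so that u ~ v holds iff u v^-1 represents an element of the
   normal closure of rels in the free group. *)
Inductive word_equiv (k : nat) (rels : seq (word k)) : word k -> word k -> Prop :=
| word_equiv_refl u : word_equiv rels u u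
| word_equiv_sym u v : word_equiv rels u v -> word_equiv rels v u
| word_equiv_trans u v w :
    word_equiv rels u v -> word_equiv rels v w -> word_equiv rels u w
| word_equiv_cat u u' v v' : word_equiv rels u u' -> word_equiv rels v v' ->
    word_equiv rels (u ++ v) (u' ++ v')
| word_equiv_cancel i b : word_equiv rels [:: (i, b); (i, ~~ b)] [::]
| word_equiv_rel r : r \in rels -> word_equiv rels r [::].

Definition generates (G : groupType) (k : nat) (a : 'I_k -> G) : Prop :=
  forall x : G, exists w : word k, word_eval a w = x.

(* The map x_i |-> a i induces an isomorphism from < x | rels > onto G. *)
Definition presents (G : groupType) (k : nat) (rels : seq (word k))
    (a : 'I_k -> G) : Prop :=
  generates a /\
  forall u v : word k, word_eval a u = word_eval a v <-> word_equiv rels u v.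

Definition has_presentation (G : groupType) (k r : nat) : Prop :=
  exists (rels : r.-tuple (word k)) (a : 'I_k -> G), presents rels a.

Definition finitely_presented (G : groupType) : Prop :=
  exists k r : nat, has_presentation G k r.

(* The value is 0 if no number satisfies P. *)
Definition least (P : nat -> Prop) : nat :=
  xget 0%N [set n | P n /\ forall m, P m -> (n <= m)%N].

(* d(G), for G finitely generated *)
Definition min_generators (G : groupType) : nat :=
  least (fun k => exists a : 'I_k -> G, generates a).

(* rho(G), for G finitely presented *)
Definition min_relators (G : groupType) : nat :=
  least (fun r => exists k : nat, has_presentation G k r).

(* Group homology with coefficients in the trivial module Z, computed by the
   (inhomogeneous) bar complex, whose term in degree n is the free abelian
   group on the n-tuples [g_1|...|g_n]. *)
Notation bar_chain G n := {freeg (n.-tuple G) / int}.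

(* The i-th face of [g_1|...|g_(n+1)] is
     [g_2|...|g_(n+1)]                    if i = 0,
     [g_1|...|g_i g_(i+1)|...|g_(n+1)]    if 0 < i < n+1,
     [g_1|...|g_n]                        if i = n+1;
   a and b below are g_(j+1) and g_(j+2), as j counts from 0. *)
Definition bar_face (G : groupType) (n : nat) (i : 'I_n.+2)
    (x : n.+1.-tuple G) : n.-tuple G :=
  [tuple let a := tnth x (widen_ord (leqnSn n) j) in
         let b := tnth x (fintype.lift ord0 j) in
         if (j.+1 < i)%N then a else if j.+1 == i then (a * b)%g else b
   | j < n].

Definition bar_boundary (G : groupType) (n : nat) :
    bar_chain G n.+1 -> bar_chain G n :=
  fglift (fun x : n.+1.-tuple G =>
    \sum_(i < n.+2) (-1) ^+ i *: << bar_face i x >>)%R.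

Definition bar_cycle (G : groupType) (n : nat) : bar_chain G n -> Prop :=
  match n with
  | 0 => fun _ => True
  | m.+1 => fun c => bar_boundary c = 0%R
  end.

(* H_n(G, Z) = 0 *)
Definition homology_vanishes (G : groupType) (n : nat) : Prop :=
  forall c : bar_chain G n, bar_cycle c ->
  exists b : bar_chain G n.+1, bar_boundary b = c.

(* Quotients of G are surjective homomorphisms out of G. *)
Definition is_quotient (G Q : groupType) (f : {multiplicative G -> Q}) : Prop :=
  forall y : Q, exists x : G, f x = y.

Definition has_nontrivial_finite_quotient (G : groupType) : Prop :=
  exists (Q : finGroupType) (f : {multiplicative G -> Q}),
    is_quotient f /\ (1 < #|Q|)%N.

Definition infinite_order (G : groupType) (x : G) : Prop :=
  forall m : nat, (0 < m)%N -> (x ^+ m)%g <> 1%g.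

Definition infinite_order_in_quotients (G : groupType) (g : G) : Prop :=
  forall (Q : groupType) (f : {multiplicative G -> Q}),
    is_quotient f -> (exists y : Q, y <> 1%g) -> infinite_order (f g).

Local Open Scope ring_scope.

Definition asympO (R : realType) (f : nat -> nat) (g : nat -> R) : Prop :=
  exists2 c : R, 0 < c & \forall n \near \oo, (f n)%:R <= c * g n.

Definition asympOmega (R : realType) (f : nat -> nat) (g : nat -> R) : Prop :=
  exists2 c : R, 0 < c & \forall n \near \oo, c * g n <= (f n)%:R.

Definition asympTheta (R : realType) (f : nat -> nat) (g : nat -> R) : Prop :=
  asympO f g /\ asympOmega f g.

(* There are presentations of the groups G^n, with k n generators and r n
   relators, such that k satisfies K and r satisfies L. *)
Definition power_presentations (G : groupType)
    (K L : (nat -> nat) -> Prop) : Prop :=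
  exists k r : nat -> nat,
    [/\ forall n, has_presentation (power G n) (k n) (r n), K k & L r].

(* Main.v *)
Require Import Defs.
From HB Require Import structures.
From mathcomp Require Import all_boot all_order all_algebra all_fingroup.
From mathcomp Require Import all_classical all_reals all_analysis.
From mathcomp Require Import generic_quotient freeg zify ring lra.

(** The upper bounds rest on one construction. Suppose that the perfect group
    [G^N] is generated by [k] elements [x_j] and that a perfect group
    [<x | R>], with [r] relators, maps onto it with central kernel. Take two
    copies [y_j], [z_j] of the generators, and as relators the commutators
    [[y_i, z_j]], the words of [R] in the products [y_j z_j], and equations
    expressing each [y_j], and each [z_j], as a fixed product of commutators of
    elements of its own copy. The two halves commute, and a word that is trivial
    in [G^N] has commutators with the [y_j] that lie in both halves, hence are
    central, hence are trivial as the half is perfect. So the new group is again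
    perfect and central over [G^(2N)], and it has [r + k^2 + 2k] relators
    ([central_presents_double]). A change of generators costs one relator for
    each new generator ([central_presents_change]), so that the number of
    generators can be kept small along the iteration: after [m] steps there are
    [O(m K^2)] relators, where [K] bounds the number of generators of the powers
    [G^(2^i)], [i <= m]. For any perfect [G], elements that are constant on a half
    of the cube [{0,1}^i] according to one coordinate show that [K] can be linear
    in [m] ([cube_gens_generate]), which gives the bound [(log n)^3]. If [g] has
    infinite order in every non-trivial quotient of [G], every power of [G] is
    generated by the diagonal and the single element [(1, g, g^2, ...)]
    ([infinite_order_generates]), so [K = d(G) + 1] and the bound is [log n].

    If [H_1(G) <> 0], the standard presentation of a direct product is good enough
    ([power_presentation]). Otherwise [G] is perfect, and it remains to kill the
    central kernel. If [H_1(G) = H_2(G) = 0], the kernel is trivial: each factor [G]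
    lifts to the extension, the lifts of distinct factors commute, and the resulting section is onto because the extension is perfect
    ([lifting_wpresents]). If only [H_1(G) = 0], one imposes on lifts of each
    factor the relators of [G], which costs [O(n)] relators
    ([factors_wpresents]). Passing from [G^(2^m)] to [G^n] costs a constant number
    of relators ([wpresents_subpower]).

    The lower bounds come from linear algebra over a finite prime field [F]. The
    number of relators of a presentation is at least the dimension of the second
    cohomology: if there are fewer relators than independent cocycles, some
    non-trivial combination defines a central extension in which all relators lift
    to the identity, so this extension splits ([relators_cohomology]). If
    [H_1(G) <> 0], there is a non-trivial [f : G -> F], and the products of the
    pull-backs of [f] to two distinct factors give about [n^2] independent classes
    ([relators_character]). If [H_1(G) = 0] and [H_2(G) <> 0], a non-trivial class
    of [G] gives [n] independent classes ([relators_cocycle]); it exists for some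
    prime because [H_2(G)] is finitely generated ([H2_character]). A finite
    quotient [Q] gives [n <= |Q|^d] for the number [d] of generators
    ([generators_quotient]), and presentations of perfect groups have at least as
    many relators as generators ([perfect_relators]). *)

Set Implicit Arguments.
Unset Strict Implicit.
Unset Printing Implicit Defensive.

Import Order.TTheory GRing.Theory Num.Theory.

Local Open Scope group_scope.

(** * Words, and homomorphisms as plain functions *)

Section Words.

Variable I : Type.

(** The value of a word over an arbitrary alphabet; for the alphabet ['I_k]
    this is [word_eval]. *)
Definition weval (G : groupType) (a : I -> G) (w : seq (I * bool)) : G :=
  \prod_(l <- w) (if l.2 then (a l.1)^-1 else a l.1).

(** Words: a letter, the formal inverse, and the formal commutator [u v u^-1 v^-1]. *)
Definition letter (i : I) : seq (I * bool) := [:: (i, false)].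

Definition winv (w : seq (I * bool)) : seq (I * bool) :=
  rev [seq (l.1, ~~ l.2) | l <- w].

Definition wcomm (u v : seq (I * bool)) := u ++ v ++ winv u ++ winv v.

Lemma weval_nil (G : groupType) (a : I -> G) : weval a [::] = 1.
Proof. exact: big_nil. Qed.

Lemma weval_cons (G : groupType) (a : I -> G) l w :
  weval a (l :: w) = (if l.2 then (a l.1)^-1 else a l.1) * weval a w.
Proof. exact: big_cons. Qed.

Lemma weval_cat (G : groupType) (a : I -> G) u v :
  weval a (u ++ v) = weval a u * weval a v.
Proof. exact: big_cat. Qed.

Lemma weval_letter (G : groupType) (a : I -> G) i : weval a (letter i) = a i.
Proof. by rewrite /weval big_seq1. Qed.

Lemma weval_winv (G : groupType) (a : I -> G) w :
  weval a (winv w) = (weval a w)^-1.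
Proof.
elim: w => [|[i b] w IH]; first by rewrite weval_nil invg1.
rewrite /winv /= rev_cons -cats1 weval_cat -/(winv w) IH.
by rewrite !weval_cons weval_nil mulg1 invgM /=; case: b; rewrite /= ?invgK.
Qed.

Lemma weval_mul (G : groupType) (a b : I -> G) w :
    (forall i j, commute (a i) (b j)) ->
  weval (fun i => a i * b i) w = weval a w * weval b w.
Proof.
move=> cab; elim: w => [|[i e] w IH]; first by rewrite !weval_nil mulg1.
have c (x : G) : (forall j, commute (a j) x) -> commute (weval a w) x.
  move=> cx; apply: commute_sym; elim: w {IH} => [|[j e'] w IH].
    by rewrite weval_nil; exact: commute1.
  rewrite weval_cons; apply: commuteM => //.
  by case: e'; rewrite /=; [apply: commuteV|]; apply: commute_sym.
rewrite !weval_cons IH /=; case: e.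
  rewrite invgM (commuteV (commute_sym (commuteV (cab i i)))) -!mulgA.
  by congr (_ * _); rewrite !mulgA (c _ (fun j => commuteV (cab j i))).
rewrite -!mulgA; congr (_ * _).
by rewrite !mulgA (c _ (fun j => cab j i)).
Qed.

Lemma weval_wcomm (G : groupType) (a : I -> G) u v :
  weval a (wcomm u v) = 1 <-> commute (weval a u) (weval a v).
Proof.
rewrite /wcomm !weval_cat !weval_winv mulgA -invgM; split=> [/divg1_eq //|->].
by rewrite mulgV.
Qed.

Lemma weval_commg (G : groupType) (a : I -> G) u v :
  weval a (winv u ++ winv v ++ u ++ v) = [~ weval a u, weval a v].
Proof. by rewrite !weval_cat !weval_winv. Qed.

Lemma weval_one (G : groupType) (w : seq (I * bool)) : weval (fun=> 1 : G) w = 1.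
Proof.
elim: w => [|[i b] w IH]; rewrite ?weval_nil // weval_cons IH /= invg1.
by rewrite if_same mulg1.
Qed.

Lemma eq_weval (G : groupType) (a b : I -> G) w :
  a =1 b -> weval a w = weval b w.
Proof. by move=> e; apply: eq_bigr => l _; rewrite e. Qed.

End Words.

(** Substitution of the words [s i] for the letters. *)
Definition wsubst (I J : Type) (s : I -> seq (J * bool)) (w : seq (I * bool)) :
    seq (J * bool) :=
  flatten [seq if l.2 then winv (s l.1) else s l.1 | l <- w].

Lemma weval_subst (I J : Type) (G : groupType) (s : I -> seq (J * bool))
    (b : J -> G) w :
  weval b (wsubst s w) = weval (fun i => weval b (s i)) w.
Proof.
elim: w => [|[i c] w IH]; first by rewrite !weval_nil.
rewrite /wsubst /= weval_cat -/(wsubst s w) IH weval_cons /=.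
by case: c; rewrite ?weval_winv.
Qed.

Section Morphisms.

Variables (G E : groupType) (f : G -> E).

Hypothesis fM : {morph f : x y / x * y}.

Lemma hom1 : f 1 = 1.
Proof. by apply: (mulgI (f 1)); rewrite -fM !mulg1. Qed.

Lemma homV x : f x^-1 = (f x)^-1.
Proof. by apply: (mulgI (f x)); rewrite -fM !mulgV hom1. Qed.

Lemma homR x y : f [~ x, y] = [~ f x, f y].
Proof. by rewrite /commg /conjg !fM !homV. Qed.

Lemma hom_weval (I : Type) (a : I -> G) w :
  f (weval a w) = weval (fun i => f (a i)) w.
Proof.
elim: w => [|[i b] w IH]; first by rewrite !weval_nil hom1.
by rewrite !weval_cons fM IH; case: b => //=; rewrite homV.
Qed.

End Morphisms.

(** * Subgroups, centres and perfect groups *)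

(** Subgroups are predicates, as membership need not be decidable. *)
Record subgroup (G : groupType) (H : G -> Prop) : Prop := Subgroup {
  subgroup1 : H 1;
  subgroupM : forall x y, H x -> H y -> H (x * y);
  subgroupV : forall x, H x -> H x^-1 }.

Lemma subgroup_weval (G : groupType) (H : G -> Prop) (I : Type) (a : I -> G) w :
  subgroup H -> (forall i, H (a i)) -> H (weval a w).
Proof.
move=> sH Ha; elim: w => [|[i b] w IH]; first by rewrite weval_nil; exact: subgroup1.
rewrite weval_cons; apply: subgroupM => //.
by case: b => //=; apply: subgroupV.
Qed.

Lemma commute_subgroup (G : groupType) (x : G) : subgroup (commute x).
Proof.
by split=> [|y z|y]; [exact: commute1 | exact: commuteM | exact: commuteV].
Qed.

Lemma commute_commg (G : groupType) (x p s : G) :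
  commute x p -> commute x s -> commute x [~ p, s].
Proof. by move=> cp cs; do ![apply: commuteM => // | apply: commuteV => //]. Qed.

(** If [p], [s] commute with [q], [t], the commutator of [p q] and [s t] is the
    product of the two commutators, so it is trivial only if these are inverse
    to each other. *)
Lemma commute_mul_commg (G : groupType) (p q s t : G) :
    commute p q -> commute p t -> commute s q -> commute s t ->
  commute (p * q) (s * t) -> [~ p, s] = [~ t, q].
Proof.
move=> pq pt sq st h; have c : commute (q * t) [~ p, s].
  by apply: commute_commg; apply/commute_sym/commuteM.
apply: (mulgI (s * p * (q * t))).
have -> : s * p * (q * t) * [~ p, s] = s * p * [~ p, s] * (q * t).
  by rewrite -!(mulgA (s * p)) c.
have -> : s * p * (q * t) * [~ t, q] = s * p * (q * t * [~ t, q]).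
  by rewrite !mulgA.
rewrite -!commgC; transitivity (p * q * (s * t)).
  by rewrite !mulgA -(mulgA p q) -sq !mulgA.
by rewrite h !mulgA -(mulgA s t) -pt !mulgA.
Qed.

(** Membership in the centre. *)
Definition central (E : groupType) (x : E) : Prop := forall y, commute x y.

Lemma central_subgroup (E : groupType) : subgroup (@central E).
Proof.
split=> [y|x y cx cy z|x cx z]; apply: commute_sym.
- exact: commute1.
- by apply: commuteM; apply: commute_sym.
- by apply: commuteV; apply: commute_sym.
Qed.

(** Two elements with the same image modulo the centre. *)
Definition eqZ (E : groupType) (x y : E) : Prop := central (x * y^-1).

Section EqZ.

Variable E : groupType.
Implicit Types x y z : E.

Lemma eqZP x y : eqZ x y <-> exists2 z, central z & x = z * y.
Proof.
split=> [c|[z c ->]]; first by exists (x * y^-1); rewrite ?mulgVK.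
by rewrite /eqZ mulgK.
Qed.

Lemma eqZ_refl x : eqZ x x.
Proof. by rewrite /eqZ mulgV; apply: subgroup1 (central_subgroup E). Qed.

Lemma eqZ_trans y x z : eqZ x y -> eqZ y z -> eqZ x z.
Proof.
by move=> c1 c2; have := subgroupM (central_subgroup E) c1 c2; rewrite mulgA mulgVK.
Qed.

Lemma eqZM x x' y y' : eqZ x x' -> eqZ y y' -> eqZ (x * y) (x' * y').
Proof.
move=> /eqZP[z cz ->] /eqZP[t ct ->]; apply/eqZP; exists (z * t).
  exact: (subgroupM (central_subgroup E)).
by rewrite -!mulgA (mulgA x' t) -(ct x') -!mulgA.
Qed.

Lemma eqZV x x' : eqZ x x' -> eqZ x^-1 x'^-1.
Proof.
move=> /eqZP[z cz ->]; apply/eqZP; exists z^-1.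
  exact: (subgroupV (central_subgroup E)).
by rewrite invgM; apply: commute_sym; apply: (subgroupV (central_subgroup E)).
Qed.

Lemma eqZR x x' y y' : eqZ x x' -> eqZ y y' -> eqZ [~ x, y] [~ x', y'].
Proof. by move=> h k; do ![apply: eqZM => // | apply: eqZV => //]. Qed.

Lemma eqZ_central x y : eqZ x y -> central y -> central x.
Proof.
by move=> /eqZP[z cz ->] cy; apply: (subgroupM (central_subgroup E)).
Qed.

Lemma central_commM x y z :
  central [~ x, z] -> [~ x * y, z] = [~ x, z] * [~ y, z].
Proof.
move=> c; have -> : [~ x * y, z] = y^-1 * ([~ x, z] * (z^-1 * (y * z))).
  by rewrite /commg /conjg invgM !mulgA mulgK.
by rewrite mulgA -(c y^-1) -mulgA.
Qed.

Lemma commgV_eq x y : [~ x, y]^-1 = [~ y, x].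
Proof. by rewrite /commg /conjg !invgM !invgK !mulgA. Qed.

End EqZ.

Section Centre.

Variable E : groupType.

Definition centralb : pred E := fun x => `[< central x >].

(** The centre of [E], written additively. *)
Definition centre := {x : E | centralb x}.

HB.instance Definition _ := Choice.on centre.

Lemma centralbP x : reflect (central x) (centralb x).
Proof. exact: asboolP. Qed.

Lemma centre_central (x : centre) : central (val x).
Proof. exact/centralbP/(valP x). Qed.

Definition centre_of (x : E) (cx : central x) : centre :=
  exist _ x (introT (centralbP x) cx).

Definition centre_add (x y : centre) : centre :=
  centre_of (subgroupM (central_subgroup E) (centre_central x) (centre_central y)).
Definition centre_opp (x : centre) : centre :=
  centre_of (subgroupV (central_subgroup E) (centre_central x)).
Definition centre_zero : centre := centre_of (subgroup1 (central_subgroup E)).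

Lemma centre_addA : associative centre_add.
Proof. by move=> x y z; apply/val_inj; rewrite /= mulgA. Qed.
Lemma centre_addC : commutative centre_add.
Proof. by move=> x y; apply/val_inj; exact: centre_central. Qed.
Lemma centre_add0 : left_id centre_zero centre_add.
Proof. by move=> x; apply/val_inj; exact: mul1g. Qed.
Lemma centre_addN : left_inverse centre_zero centre_opp centre_add.
Proof. by move=> x; apply/val_inj; exact: mulVg. Qed.

HB.instance Definition _ := GRing.isZmodule.Build centre
  centre_addA centre_addC centre_add0 centre_addN.

Lemma val_centreD (x y : centre) : val (x + y)%R = val x * val y.
Proof. by []. Qed.

End Centre.

(** [P] is perfect: it has no non-trivial homomorphism to an abelian group. *)
Definition perfect (P : groupType) : Prop :=
  forall (A : zmodType) (f : P -> A),
    {morph f : x y / x * y >-> (x + y)%R} -> forall x, f x = 0%R.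

Lemma perfect_central (P E : groupType) (f : P -> E) :
    perfect P -> {morph f : x y / x * y} -> (forall x, central (f x)) ->
  forall x, f x = 1.
Proof.
move=> pP fM fc x; pose g x := centre_of (fc x).
have gM : {morph g : x y / x * y >-> (x + y)%R}.
  by move=> y z; apply/val_inj; exact: fM.
by have /(congr1 val) := pP _ g gM x.
Qed.

(** The value of a word in an abelian group written additively. *)
Definition asum (I : Type) (A : zmodType) (b : I -> A) (w : seq (I * bool)) : A :=
  (\sum_(l <- w) if l.2 then - b l.1 else b l.1)%R.

(** The words of the derived subgroup of the free group: their value in every
    abelian group is trivial. *)
Definition balanced (I : Type) (w : seq (I * bool)) : Prop :=
  forall (A : zmodType) (b : I -> A), asum b w = 0%R.

Section Asum.

Variables (I : Type) (A : zmodType).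
Implicit Type b : I -> A.

Lemma asum_nil b : asum b [::] = 0%R.
Proof. exact: big_nil. Qed.

Lemma asum_cons b l w :
  asum b (l :: w) = ((if l.2 then - b l.1 else b l.1) + asum b w)%R.
Proof. exact: big_cons. Qed.

Lemma asum_cat b u v : asum b (u ++ v) = (asum b u + asum b v)%R.
Proof. exact: big_cat. Qed.

Lemma asum_letter b i : asum b (letter i) = b i.
Proof. by rewrite /asum big_seq1. Qed.

Lemma asum_winv b w : asum b (winv w) = (- asum b w)%R.
Proof.
elim: w => [|[i c] w IH]; first by rewrite !asum_nil oppr0.
rewrite /winv /= rev_cons -cats1 asum_cat -/(winv w) IH.
rewrite addrC !asum_cons asum_nil addr0 opprD /=; congr (_ - _)%R.
by case: c; rewrite /= ?opprK.
Qed.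

End Asum.

Lemma asum_subst (I J : Type) (A : zmodType) (s : J -> seq (I * bool))
    (b : I -> A) w :
  asum b (wsubst s w) = asum (fun j => asum b (s j)) w.
Proof.
elim: w => [|[i c] w IH]; first by rewrite !asum_nil.
rewrite /wsubst /= asum_cat -/(wsubst s w) IH asum_cons /=.
by case: c; rewrite ?asum_winv.
Qed.

Lemma balanced_wcomm (I : Type) (u v : seq (I * bool)) : balanced (wcomm u v).
Proof.
move=> A b; rewrite /wcomm !asum_cat !asum_winv addrA -opprD.
by rewrite subrr.
Qed.

Lemma balanced_subst (I J : Type) (s : I -> seq (J * bool)) w :
  balanced w -> balanced (wsubst s w).
Proof. by move=> bw A b; rewrite asum_subst bw. Qed.

Lemma balanced_subst_in (I J : Type) (s : I -> seq (J * bool)) w :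
  (forall i, balanced (s i)) -> balanced (wsubst s w).
Proof.
move=> bs A b; rewrite asum_subst; elim: w => [|[i c] w IH].
  by rewrite asum_nil.
by rewrite asum_cons IH bs oppr0 addr0; case: c.
Qed.

(** A homomorphism from the free group to the centre of a group kills the
    balanced words. *)
Lemma balanced_central (I : Type) (E : groupType) (h : seq (I * bool) -> E) w :
    (forall u, central (h u)) -> {morph h : u v / u ++ v >-> u * v} ->
    (forall i, h [:: (i, false); (i, true)] = h [::]) ->
  balanced w -> h w = 1.
Proof.
move=> hc hM h0 bw; pose g u := centre_of (hc u).
have h1 : h [::] = 1 by apply: (mulgI (h [::])); rewrite -hM mulg1.
have hV i : h [:: (i, true)] = (h [:: (i, false)])^-1.
  by apply: (mulgI (h (letter i))); rewrite mulgV -hM h0.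
have -> : h w = val (asum (fun i => g (letter i)) w).
  elim: w {bw} => [|[i b] w IH]; first by rewrite asum_nil h1.
  rewrite -cat1s hM IH asum_cons val_centreD; congr (_ * _).
  by case: b; rewrite /= ?hV.
by rewrite bw.
Qed.

(** * Quotients by congruences *)

(** A congruence on a set of representatives, whose classes form a group. *)
Record group_congruence (W : Type) (mul : W -> W -> W) (one : W) (inv : W -> W)
    (R : W -> W -> Prop) : Prop := GroupCongruence {
  congR : forall x, R x x;
  congS : forall x y, R x y -> R y x;
  congT : forall y x z, R x y -> R y z -> R x z;
  congM : forall x x' y y', R x x' -> R y y' -> R (mul x y) (mul x' y');
  congA : forall x y z, R (mul x (mul y z)) (mul (mul x y) z);
  cong1m : forall x, R (mul one x) x;
  congm1 : forall x, R (mul x one) x;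
  congVm : forall x, R (mul (inv x) x) one;
  congmV : forall x, R (mul x (inv x)) one }.

Section CongruenceQuotient.

Local Open Scope quotient_scope.

Variables (W : choiceType) (mul : W -> W -> W) (one : W) (inv : W -> W).
Variables (R : W -> W -> Prop) (cR : group_congruence mul one inv R).

Definition congb : rel W := fun x y => `[< R x y >].

Lemma congb_equiv : equiv_class_of congb.
Proof.
split=> [x|x y|y x z].
- exact/asboolP/(congR cR).
- by apply/asboolP/asboolP; apply: (congS cR).
- by move=> /asboolP h /asboolP h'; apply/asboolP; exact: (congT cR h h').
Qed.

Canonical cong_equiv := EquivRelPack congb_equiv.

(** The group of congruence classes. *)
Definition cong_quot : Type := {eq_quot cong_equiv}.

HB.instance Definition _ := Choice.on cong_quot.

Definition cong_class (x : W) : cong_quot := \pi_({eq_quot cong_equiv}) x.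
Definition cong_repr (q : cong_quot) : W := repr (q : {eq_quot cong_equiv}).

Lemma cong_reprK q : cong_class (cong_repr q) = q.
Proof. exact: reprK. Qed.

Lemma cong_classE x y : cong_class x = cong_class y <-> R x y.
Proof.
by split=> [/eqmodP/asboolP //|h]; apply/eqmodP/asboolP.
Qed.

Lemma cong_repr_class x : R (cong_repr (cong_class x)) x.
Proof. by apply/cong_classE; rewrite cong_reprK. Qed.

Definition cong_mul p q := cong_class (mul (cong_repr p) (cong_repr q)).
Definition cong_inv p := cong_class (inv (cong_repr p)).
Definition cong_one := cong_class one.

Lemma cong_classM x y :
  cong_class (mul x y) = cong_mul (cong_class x) (cong_class y).
Proof.
apply/cong_classE/(congS cR)/(congM cR); exact: cong_repr_class.
Qed.

Lemma cong_mulA : associative cong_mul.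
Proof.
move=> p q r; rewrite -(cong_reprK p) -(cong_reprK q) -(cong_reprK r).
by rewrite -!cong_classM; apply/cong_classE/(congA cR).
Qed.

Lemma cong_mul1 : left_id cong_one cong_mul.
Proof.
move=> p; rewrite -(cong_reprK p) -cong_classM.
exact/cong_classE/(cong1m cR).
Qed.

Lemma cong_mulr1 : right_id cong_one cong_mul.
Proof.
move=> p; rewrite -(cong_reprK p) -cong_classM.
exact/cong_classE/(congm1 cR).
Qed.

Lemma cong_mulV : left_inverse cong_one cong_inv cong_mul.
Proof.
move=> p; rewrite -{2}(cong_reprK p) -cong_classM.
exact/cong_classE/(congVm cR).
Qed.

Lemma cong_mulrV : right_inverse cong_one cong_inv cong_mul.
Proof.
move=> p; rewrite -{1}(cong_reprK p) -cong_classM.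
exact/cong_classE/(congmV cR).
Qed.

HB.instance Definition _ := isGroup.Build cong_quot
  cong_mulA cong_mul1 cong_mulr1 cong_mulV cong_mulrV.

End CongruenceQuotient.

Lemma congruence_quotient (W : choiceType) mul (one : W) inv R :
    group_congruence mul one inv R ->
  exists (Q : groupType) (p : W -> Q),
    [/\ {morph p : x y / mul x y >-> x * y}, forall q, exists x, p x = q
      & forall x y, p x = p y <-> R x y].
Proof.
move=> cR; exists (cong_quot cR), (cong_class cR); split.
- exact: cong_classM.
- by move=> q; exists (cong_repr q); exact: cong_reprK.
- exact: cong_classE.
Qed.

Lemma normal_quotient (G : groupType) (N : G -> Prop) :
    subgroup N -> (forall x y, N x -> N (x ^ y)) ->
  exists (Q : groupType) (f : G -> Q),
    [/\ {morph f : x y / x * y}, forall q, exists x, f x = q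
      & forall x, f x = 1 <-> N x].
Proof.
move=> sN nN; pose R x y := N (x * y^-1).
have cR : group_congruence *%g 1 (fun x : G => x^-1) R.
  rewrite /R; split=> [x|x y h|y x z h1 h2|x x' y y' h1 h2|x y z|x|x|x|x].
  - by rewrite mulgV; apply: subgroup1.
  - by have := subgroupV sN h; rewrite invgM invgK.
  - by have := subgroupM sN h1 h2; rewrite mulgA mulgVK.
  - have -> : x * y * (x' * y')^-1 = (y * y'^-1) ^ x^-1 * (x * x'^-1).
      by rewrite /conjg invgM invgK !mulgA mulgVK.
    by apply: subgroupM => //; apply: nN.
  - by rewrite mulgA mulgV; apply: subgroup1.
  - by rewrite mul1g mulgV; apply: subgroup1.
  - by rewrite mulg1 mulgV; apply: subgroup1.
  - by rewrite mulVg mulgV; apply: subgroup1.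
  - by rewrite !mulgV; apply: subgroup1.
have [Q [f [fM fS fE]]] := congruence_quotient cR.
exists Q, (f : G -> Q); split=> // x.
by rewrite -(hom1 fM) fE /R invg1 mulg1.
Qed.

(** A subgroup of a perfect group that contains the commutators is everything,
    as the quotient by it is abelian. *)
Lemma perfect_subgroup (P : groupType) (T : P -> Prop) :
    perfect P -> subgroup T -> (forall x y, T [~ x, y]) -> forall x, T x.
Proof.
move=> pP sT cT; have nT x y : T x -> T (x ^ y).
  move=> Tx; have -> : x ^ y = x * [~ x, y] by rewrite /commg mulVKg.
  exact: subgroupM.
have [Q [f [fM fS fE]]] := normal_quotient sT nT.
have fc x : central (f x).
  move=> q; have [y <-] := fS q.
  by apply/commgP/eqP; rewrite -(homR fM); apply/fE.
by move=> x; apply/fE; apply: (perfect_central pP fM fc).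
Qed.

(** * Presentations over arbitrary finite alphabets *)

(** The relators are trivial in [E]: [b] extends to a homomorphism from
    <I | rels>. *)
Definition satisfies (I : choiceType) (rels : seq (seq (I * bool))) (E : groupType)
    (b : I -> E) : Prop :=
  forall r, r \in rels -> weval b r = 1.

(** The family [a] generates [G]. *)
Definition wgenerates (I : Type) (G : groupType) (a : I -> G) : Prop :=
  forall x, exists w, weval a w = x.

(** The word [u] represents the identity of <I | rels>. *)
Definition entails (I : choiceType) (rels : seq (seq (I * bool))) (u : seq (I * bool))
    : Prop :=
  forall (E : groupType) (b : I -> E), satisfies rels b -> weval b u = 1.

(** The map [a] induces an isomorphism from <I | rels> onto [G]. *)
Definition wpresents (I : choiceType) (G : groupType) (rels : seq (seq (I * bool)))
    (a : I -> G) : Prop :=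
  [/\ wgenerates a, satisfies rels a
    & forall u, weval a u = 1 -> entails rels u].

Lemma weval_eq1 (I : choiceType) (E : groupType) (b : I -> E) u v :
  weval b (u ++ winv v) = 1 <-> weval b u = weval b v.
Proof.
rewrite weval_cat weval_winv; split=> [/divg1_eq //|->]; exact: mulgV.
Qed.

Lemma entails_congruence (I : choiceType) (rels : seq (seq (I * bool))) :
  group_congruence cat [::] (@winv I) (fun u v => entails rels (u ++ winv v)).
Proof.
split=> [x|x y h|y x z h h'|x x' y y' h h'|x y z|x|x|x|x] E b sb;
  apply/weval_eq1; rewrite ?(weval_cat, weval_winv, weval_nil).
- by [].
- by apply/esym/weval_eq1/h.
- by transitivity (weval b y); apply/weval_eq1; [apply: h | apply: h'].
- by congr (_ * _); apply/weval_eq1; [apply: h | apply: h'].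
- exact: mulgA.
- by rewrite ?mul1g.
- by rewrite ?mulg1.
- exact: mulVg.
- exact: mulgV.
Qed.

(** A homomorphism from words to a group that respects cancellation is the
    evaluation at the images of the letters. *)
Lemma weval_quotient (I : Type) (Q : groupType) (p : seq (I * bool) -> Q) :
    {morph p : u v / u ++ v >-> u * v} ->
    (forall i, p [:: (i, false); (i, true)] = p [::]) ->
  forall w, weval (fun i => p (letter i)) w = p w.
Proof.
move=> pM pV; have p1 : p [::] = 1 by apply: (mulgI (p [::])); rewrite -pM mulg1.
elim=> [|[i c] w IH]; first by rewrite weval_nil.
rewrite -cat1s pM weval_cons IH; congr (_ * _); case: c => //=.
by apply: (mulgI (p (letter i))); rewrite mulgV -pM pV p1.
Qed.

(** The group <I | rels>. *)
Lemma presented_group (I : choiceType) (rels : seq (seq (I * bool))) :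
  exists (Q : groupType) (b : I -> Q),
    [/\ wgenerates b, satisfies rels b & forall u, weval b u = 1 <-> entails rels u].
Proof.
have [Q [p [pM pS pE]]] := congruence_quotient (entails_congruence rels).
pose b i := p (letter i).
have p1 : p [::] = 1 by apply: (mulgI (p [::])); rewrite -pM mulg1.
have evE : forall w, weval b w = p w.
  apply: weval_quotient pM _ => i; apply/pE => E d _.
  by rewrite !weval_cons !weval_nil /= !mulg1 mulgV.
have bE u : weval b u = 1 <-> entails rels u.
  rewrite evE -p1 pE; split=> h E d sd; have := h E d sd.
    by rewrite weval_cat weval_winv weval_nil invg1 mulg1.
  by rewrite weval_cat weval_winv weval_nil invg1 mulg1.
exists Q, b; split=> // [x|r rin].
  by have [w <-] := pS x; exists w.
by apply/bE => E d; apply.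
Qed.

(** It suffices to test a relation in the groups generated by the images of the
    letters. *)
Lemma entails_gen (I : choiceType) (rels : seq (seq (I * bool))) u :
  (forall (E : groupType) (b : I -> E),
     wgenerates b -> satisfies rels b -> weval b u = 1) -> entails rels u.
Proof.
by move=> h; have [Q [b [gb sb bE]]] := presented_group rels; apply/bE/h.
Qed.

(** The universal property of a presentation. *)
Lemma wpresents_hom (I : choiceType) (G E : groupType) (rels : seq (seq (I * bool)))
    (a : I -> G) (b : I -> E) :
    wpresents rels a -> satisfies rels b ->
  exists2 f : G -> E, {morph f : x y / x * y} & forall i, f (a i) = b i.
Proof.
move=> [ga sa ea] sb; have [w wE] := choice ga.
have fE u : weval b (w (weval a u)) = weval b u.
  by apply/weval_eq1/ea/sb/weval_eq1/wE.
exists (fun x => weval b (w x)) => [x y|i].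
  by rewrite -{1}(wE x) -{1}(wE y) -weval_cat fE weval_cat.
by rewrite -{1}(weval_letter a i) fE weval_letter.
Qed.

Section Bridge.

Variables (k : nat) (rels : seq (word k)).

Lemma winv_equiv (u v : word k) : word_equiv rels (u ++ winv u) [::].
Proof.
elim: u => [|[i b] u IH] /=; first exact: word_equiv_refl.
rewrite /winv /= rev_cons -cats1 -/(winv u).
apply: (@word_equiv_trans _ _ _ ([:: (i, b)] ++ ([::] ++ [:: (i, ~~ b)]))).
  rewrite -[_ :: _]/([:: (i, b)] ++ (u ++ (winv u ++ [:: (i, ~~ b)]))).
  apply: word_equiv_cat; first exact: word_equiv_refl.
  by rewrite catA; apply: word_equiv_cat => //; exact: word_equiv_refl.
exact: word_equiv_cancel.
Qed.

Lemma winvK : involutive (@winv 'I_k).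
Proof.
move=> u; rewrite /winv map_rev revK -map_comp.
by rewrite -[RHS]map_id; apply: eq_map => -[i b] /=; rewrite negbK.
Qed.

Lemma word_equiv_congruence :
  group_congruence cat [::] (@winv 'I_k) (word_equiv rels).
Proof.
split=> [x|x y|y x z|x x' y y'|x y z|x|x|x|x].
- exact: word_equiv_refl.
- exact: word_equiv_sym.
- exact: word_equiv_trans.
- exact: word_equiv_cat.
- by rewrite catA; exact: word_equiv_refl.
- exact: word_equiv_refl.
- by rewrite cats0; exact: word_equiv_refl.
- by rewrite -{2}(winvK x); exact: winv_equiv.
- exact: winv_equiv.
Qed.

Lemma word_equiv_sound (E : groupType) (b : 'I_k -> E) u v :
  satisfies rels b -> word_equiv rels u v -> weval b u = weval b v.
Proof.
move=> sb; elim=> [|? ? ? ->|? ? ? ? -> ? ->|||] //.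
- by move=> ? ? ? ? _ h _ h'; rewrite !weval_cat h h'.
- move=> i c; rewrite !weval_cons weval_nil mulg1.
  by case: c; rewrite /= ?mulVg ?mulgV.
- by move=> r rin; rewrite weval_nil; apply: sb.
Qed.

End Bridge.

Lemma presents_wpresents (G : groupType) k (rels : seq (word k)) (a : 'I_k -> G) :
  presents rels a <-> wpresents rels a.
Proof.
split=> [[ga aE]|[ga sa ea]].
  split=> [//|r rin|u u1 E b sb].
    by rewrite -(weval_nil a); apply/aE/word_equiv_rel.
  rewrite -(weval_nil b); apply: word_equiv_sound sb _.
  by apply/aE; rewrite -[word_eval a u]/(weval a u) u1 -(weval_nil a).
split=> // u v; split; last exact: word_equiv_sound.
have [Q [p [pM _ pE]]] := congruence_quotient (word_equiv_congruence rels).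
have pV i : p [:: (i, false); (i, true)] = p [::].
  by apply/pE; exact: (word_equiv_cancel rels i false).
have p1 : p [::] = 1 by apply: (mulgI (p [::])); rewrite -pM mulg1.
have evE := weval_quotient pM pV.
move=> /(weval_eq1 a u v)/ea h; apply/pE; rewrite -!evE.
apply/weval_eq1/h => r rin; rewrite evE -p1; apply/pE.
exact: word_equiv_rel.
Qed.

Lemma has_presentationE (G : groupType) k r :
  has_presentation G k r <->
  exists2 rels : seq (word k), size rels = r
    & exists a : 'I_k -> G, wpresents rels a.
Proof.
split=> [[rels [a /presents_wpresents pa]]|[rels <- [a pa]]].
  by exists rels; [exact: size_tuple | exists a].
by exists (in_tuple rels), a; apply/presents_wpresents.
Qed.

Lemma wpresents_has_presentation (I : finType) (G : groupType)
    (rels : seq (seq (I * bool))) (a : I -> G) :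
  wpresents rels a -> has_presentation G #|I| (size rels).
Proof.
move=> [ga sa ea]; pose s i := letter (enum_rank i : 'I_#|I|).
pose t (j : 'I_#|I|) := letter (enum_val j : I).
have sE (E : groupType) (b : 'I_#|I| -> E) w :
    weval b (wsubst s w) = weval (fun i => b (enum_rank i)) w.
  by rewrite weval_subst; apply: eq_weval => i; rewrite weval_letter.
have tE (E : groupType) (b : I -> E) w :
    weval b (wsubst t w) = weval (fun j => b (enum_val j)) w.
  by rewrite weval_subst; apply: eq_weval => i; rewrite weval_letter.
apply/has_presentationE; exists (map (wsubst s) rels); first exact: size_map.
exists (fun j => a (enum_val j)); split.
- move=> x; have [w <-] := ga x; exists (wsubst s w); rewrite sE.
  by apply: eq_weval => i; rewrite enum_rankK.
- move=> _ /mapP[r rin ->]; rewrite sE -[RHS](sa r rin).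
  by apply: eq_weval => i; rewrite enum_rankK.
- move=> u; rewrite -tE => /ea h E b sb.
  have := h E (fun i => b (enum_rank i)); rewrite tE => <-.
    by apply: eq_weval => j; rewrite enum_valK.
  by move=> r rin; rewrite -sE; apply: sb; exact: map_f.
Qed.

Lemma wpresents_pad (I : choiceType) (G : groupType)
    (rels : seq (seq (I * bool))) (a : I -> G) m :
  wpresents rels a -> wpresents (rels ++ nseq m [::]) a.
Proof.
move=> [ga sa ea]; split=> // [r|u /ea h E b sb].
  by rewrite mem_cat => /orP[/sa //|/nseqP[-> _]]; exact: weval_nil.
by apply: h => r rin; apply: sb; rewrite mem_cat rin.
Qed.

Lemma has_presentation_leq (G : groupType) k r r' :
  has_presentation G k r -> (r <= r')%N -> has_presentation G k r'.
Proof.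
move=> /has_presentationE[rels <- [a pa]] ler.
apply/has_presentationE; exists (rels ++ nseq (r' - size rels) [::]).
  by rewrite size_cat size_nseq subnKC.
by exists a; exact: wpresents_pad.
Qed.

Lemma has_presentation_finType (I : finType) (G : groupType)
    (rels : seq (seq (I * bool))) (a : I -> G) r :
  wpresents rels a -> (size rels <= r)%N -> has_presentation G #|I| r.
Proof. by move=> /wpresents_has_presentation; exact: has_presentation_leq. Qed.

(** * Direct powers *)

Section Power.

Variables (T : finType) (G : groupType).
Implicit Types (t : T) (x y : {ffun T -> G}) (g h : G).

(** The element with value [g] on the points satisfying [P] and 1 elsewhere. *)
Definition pinj (P : pred T) g : {ffun T -> G} := [ffun t => if P t then g else 1].

Lemma mul_ffunE x y t : (x * y) t = x t * y t.
Proof. exact: ffunE. Qed.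

Lemma one_ffunE t : (1 : {ffun T -> G}) t = 1.
Proof. exact: ffunE. Qed.

Lemma inv_ffunE x t : x^-1 t = (x t)^-1.
Proof. exact: ffunE. Qed.

Lemma commg_ffunE x y t : [~ x, y] t = [~ x t, y t].
Proof. exact: (homR (fun u v => mul_ffunE u v t)). Qed.

Lemma pinjM P : {morph pinj P : g h / g * h}.
Proof.
by move=> g h; apply/ffunP => t; rewrite mul_ffunE !ffunE; case: ifP; rewrite ?mulg1.
Qed.

Lemma weval_ffunE (I : Type) (a : I -> {ffun T -> G}) w t :
  weval a w t = weval (fun i => a i t) w.
Proof. exact: (hom_weval (fun u v => mul_ffunE u v t)). Qed.

Lemma pinj_commute (P Q : pred T) g h :
  (forall t, P t -> Q t -> False) -> commute (pinj P g) (pinj Q h).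
Proof.
move=> PQ; apply/ffunP => t; rewrite !mul_ffunE !ffunE.
case Pt: (P t); case Qt: (Q t); rewrite ?mulg1 ?mul1g //.
by case: (PQ t).
Qed.

Lemma commg_pinj (P Q : pred T) g h :
  [~ pinj P g, pinj Q h] = pinj (fun t => P t && Q t) [~ g, h].
Proof.
apply/ffunP => t; rewrite commg_ffunE !ffunE /=.
by case: (P t); case: (Q t) => /=; rewrite ?comm1g ?commg1.
Qed.

(** An element is the product of its coordinates. *)
Lemma ffun_prod x : x = \prod_(t <- enum T) pinj (pred1 t) (x t).
Proof.
apply/ffunP => t.
rewrite (big_morph (fun x => x t) (fun u v => mul_ffunE u v t) (one_ffunE t)).
have : t \in enum T by rewrite mem_enum.
elim: (enum T) (enum_uniq T) => //= s l IH /andP[sl ul]; rewrite inE big_cons ffunE /=.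
have [->|ts] /= := eqVneq t s.
  move=> _; rewrite big1_seq ?mulg1 // => r /andP[_ rl].
  by rewrite ffunE /=; case: eqVneq rl sl => // -> ->.
by move=> tl; rewrite mul1g; exact: IH.
Qed.

Lemma ffun_induct (H : {ffun T -> G} -> Prop) : subgroup H ->
  (forall t g, H (pinj (pred1 t) g)) -> forall x, H x.
Proof.
move=> sH Hp x; rewrite [x]ffun_prod; elim/big_ind: _ => //.
- exact: subgroup1.
- by move=> u v; apply: subgroupM.
Qed.

Lemma perfect_power : perfect G -> perfect {ffun T -> G}.
Proof.
move=> pG A f fM.
have f1 : f 1 = 0%R by apply: (addrI (f 1)); rewrite -fM mulg1 addr0.
apply: ffun_induct => [|t g].
  split=> [//|x y fx fy|x fx]; first by rewrite fM fx fy addr0.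
  by apply: (addrI (f x)); rewrite -fM mulgV f1 fx addr0.
by apply: (pG _ (fun g => f (pinj (pred1 t) g))) => u v; rewrite pinjM fM.
Qed.

(** A subgroup of [G^T], [G] perfect, is everything as soon as it contains, for
    all distinct points [s] and [t] and all [g], an element with value [g] at
    [s] and 1 at [t]: the commutators of such elements have values that cover
    [G] at [s], and are trivial at more and more points. *)
Lemma power_generation (H : {ffun T -> G} -> Prop) :
    perfect G -> subgroup H ->
    (forall t g, exists2 x, H x & x t = g) ->
    (forall s t g, s != t -> exists2 x, H x & x s = g /\ x t = 1) ->
  forall x, H x.
Proof.
move=> pG sH H1 H2; apply: ffun_induct => // s g.
suff h (l : seq T) : s \notin l -> forall g, exists2 x, H x & x s = g /\ {in l, forall t, x t = 1}.
  have [|x Hx [xs xl]] := h (rem s (enum T)) _ g.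
    by rewrite mem_rem_uniqF ?enum_uniq.
  suff <- : x = pinj (pred1 s) g by [].
  apply/ffunP => t; rewrite ffunE /=; case: eqVneq => [->//|ts].
  by apply: xl; rewrite mem_rem_uniq ?enum_uniq // !inE ts mem_enum.
elim: l => [_ {}g|t l IH].
  by have [x Hx xs] := H1 s g; exists x.
rewrite inE negb_or => /andP[st sl].
apply: perfect_subgroup => //.
  split=> [|x y [u Hu [<- ul]] [v Hv [<- vl]]|x [u Hu [<- ul]]].
  - by exists 1; [exact: subgroup1|split=> [|r _]; rewrite one_ffunE].
  - exists (u * v); first exact: subgroupM.
    by split=> [|r rl]; rewrite mul_ffunE // ul ?vl ?mulg1.
  - exists u^-1; first exact: subgroupV.
    by split=> [|r rl]; rewrite inv_ffunE // ul ?invg1.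
move=> x y; have [u Hu [<- ut]] := H2 s t x st.
have [v Hv [<- vl]] := IH sl y.
exists [~ u, v].
  rewrite /commg /conjg; do ![apply: subgroupM => // | apply: subgroupV => //].
split=> [|r]; rewrite commg_ffunE // inE => /orP[/eqP ->|/vl ->].
  by rewrite ut comm1g.
exact: commg1.
Qed.

End Power.

(** * Presentations up to central extension *)

(** The group <I | rels> is perfect and maps onto [P], by [letter i |-> a i],
    with central kernel. *)
Definition central_presents (I : choiceType) (P : groupType)
    (rels : seq (seq (I * bool))) (a : I -> P) : Prop :=
  [/\ wgenerates a, satisfies rels a,
      forall u i, weval a u = 1 -> entails rels (wcomm u (letter i))
    & forall i, exists2 c, balanced c & entails rels (letter i ++ winv c)].

(** The elements of a perfect group are values of balanced words: these values
    form a subgroup containing the commutators. *)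
Lemma perfect_balanced (I : Type) (P : groupType) (a : I -> P) :
    perfect P -> wgenerates a ->
  forall x, exists2 c, balanced c & weval a c = x.
Proof.
move=> pP ga; apply: perfect_subgroup => //.
  split=> [|x y [c bc <-] [d bd <-]|x [c bc <-]].
  - by exists [::]; [move=> A b; exact: asum_nil|exact: weval_nil].
  - exists (c ++ d); last exact: weval_cat.
    by move=> A b; rewrite asum_cat bc bd addr0.
  - exists (winv c); last exact: weval_winv.
    by move=> A b; rewrite asum_winv bc oppr0.
move=> x y; have [[u <-] [v <-]] := (ga x, ga y).
exists (wcomm (winv u) (winv v)); first exact: balanced_wcomm.
by rewrite /wcomm !weval_cat !weval_winv !invgK.
Qed.

Lemma wpresents_central (I : choiceType) (P : groupType)
    (rels : seq (seq (I * bool))) (a : I -> P) :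
  perfect P -> wpresents rels a -> central_presents rels a.
Proof.
move=> pP [ga sa ea]; split=> // [u i u1 E b sb|i].
  by apply/weval_wcomm; rewrite (ea u u1 E b sb); apply/commute_sym/commute1.
have [c bc ca] := perfect_balanced pP ga (a i).
by exists c => //; apply: ea; apply/weval_eq1; rewrite weval_letter.
Qed.

Section UseCentral.

Variables (I : choiceType) (P : groupType) (rels : seq (seq (I * bool))).
Variables (a : I -> P) (E : groupType) (b : I -> E).
Hypotheses (ha : central_presents rels a) (sb : satisfies rels b).

Lemma central_presents_commute u i : weval a u = 1 -> commute (weval b u) (b i).
Proof.
case: ha => _ _ /(_ u i) h _ /h/(_ E b sb)/weval_wcomm.
by rewrite weval_letter.
Qed.

Lemma central_presents_commute_word u w :
  weval a u = 1 -> commute (weval b u) (weval b w).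
Proof.
move=> u1; apply: subgroup_weval (commute_subgroup _) _ => i.
exact: central_presents_commute.
Qed.

Hypothesis gb : wgenerates b.

Lemma central_presents_central u : weval a u = 1 -> central (weval b u).
Proof.
by move=> u1 y; have [w <-] := gb y; exact: central_presents_commute_word.
Qed.

Lemma central_presents_eqZ u v : weval a u = weval a v -> eqZ (weval b u) (weval b v).
Proof.
move/weval_eq1/central_presents_central.
by rewrite weval_cat weval_winv.
Qed.

End UseCentral.

(** If [f] is a homomorphism on [P] that agrees modulo the centre with the map
    of words [b], then it agrees with it: both are homomorphisms on the perfect
    group <I | rels>. *)
Lemma central_presents_lift (I : choiceType) (P : groupType)
    (rels : seq (seq (I * bool))) (a : I -> P) (E : groupType) (b : I -> E)
    (f : P -> E) :
    central_presents rels a -> satisfies rels b -> {morph f : x y / x * y} ->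
    (forall w, eqZ (f (weval a w)) (weval b w)) ->
  forall w, f (weval a w) = weval b w.
Proof.
move=> [ga sa ca pa] sb fM fb w; rewrite (hom_weval fM); apply: eq_weval => i.
have [c bc ec] := pa i.
have {1}<- : weval a c = a i by rewrite -(weval_letter a i); apply/esym/weval_eq1/ec.
have <- : weval b c = b i by rewrite -(weval_letter b i); apply/esym/weval_eq1/ec.
apply: divg1_eq; pose h w := f (weval a w) * (weval b w)^-1.
apply: (balanced_central (h := h)) bc => [u|u v|j]; first exact: fb.
  rewrite /h !weval_cat fM invgM -!mulgA; congr (_ * _).
  by rewrite mulgA (fb v).
by rewrite /h !weval_cons !weval_nil /= !mulg1 !mulgV.
Qed.

(** From a central presentation of [G^T] to one of [G^(bool * T)]. *)
Section Doubling.

Variables (T : finType) (G : groupType) (I : finType).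
Variables (rels : seq (seq (I * bool))) (a : I -> {ffun T -> G}).
Variable c : I -> seq (I * bool).
Hypothesis ha : central_presents rels a.
Hypothesis bc : forall i, balanced (c i).
Hypothesis ec : forall i, entails rels (letter i ++ winv (c i)).

(** The letter [i] in one of the two copies of the alphabet. *)
Definition copy (v : bool) (i : I) : seq ((I + I) * bool) :=
  letter (if v then inr i else inl i).

(** The projection of the alphabet onto one of its copies, which erases the
    other. *)
Definition proj (v : bool) (x : I + I) : seq (I * bool) :=
  match x with
  | inl i => if v then [::] else letter i
  | inr i => if v then letter i else [::]
  end.

(** The generators of each half of [G^(bool * T)]. *)
Definition double_gen (x : I + I) : {ffun bool * T -> G} :=
  [ffun p => match x with
             | inl i => if p.1 then 1 else a i p.2
             | inr i => if p.1 then a i p.2 else 1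
             end].

(** The relators of [G^T] in the products of corresponding letters, the
    commutators of letters of distinct copies, and the equations [i = c i] in each
    copy, which make both halves perfect. *)
Definition double_rels : seq (seq ((I + I) * bool)) :=
  [seq wsubst (fun i => copy false i ++ copy true i) r | r <- rels] ++
  [seq wcomm (copy false i) (copy true j) | i <- enum I, j <- enum I] ++
  [seq wsubst (copy false) (letter i ++ winv (c i)) | i <- enum I] ++
  [seq wsubst (copy true) (letter i ++ winv (c i)) | i <- enum I].

Lemma size_double_rels :
  size double_rels = (size rels + #|I| ^ 2 + 2 * #|I|)%N.
Proof.
rewrite !size_cat !size_map size_allpairs -?enumT -!cardE mulnn.
by rewrite mul2n -addnn !addnA.
Qed.

Lemma weval_copy (E : groupType) (b : I + I -> E) v w :
  weval b (wsubst (copy v) w) = weval (fun i => b (if v then inr i else inl i)) w.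
Proof. by rewrite weval_subst; apply: eq_weval => i; rewrite weval_letter. Qed.

Lemma double_relsP (E : groupType) (b : I + I -> E) :
  satisfies double_rels b <->
  [/\ satisfies rels (fun i => b (inl i) * b (inr i)),
      forall i j, commute (b (inl i)) (b (inr j))
    & forall v i, weval (fun i => b (if v then inr i else inl i)) (c i) =
                  b (if v then inr i else inl i)].
Proof.
have dE r : weval b (wsubst (fun i => copy false i ++ copy true i) r) =
            weval (fun i => b (inl i) * b (inr i)) r.
  by rewrite weval_subst; apply: eq_weval => i; rewrite weval_cat !weval_letter.
have cE v i : weval b (wsubst (copy v) (letter i ++ winv (c i))) = 1 <->
    weval (fun i => b (if v then inr i else inl i)) (c i) =
    b (if v then inr i else inl i).
  by rewrite weval_copy weval_eq1 weval_letter; split.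
split=> [sb|[sb cb pb] r].
  split=> [r rin|i j|v i].
  - by rewrite -dE; apply: sb; rewrite mem_cat map_f.
  - have /weval_wcomm : weval b (wcomm (copy false i) (copy true j)) = 1.
      apply: sb; rewrite !mem_cat; apply/or3P; apply: Or32.
      by apply/allpairsP; exists (i, j); rewrite !mem_enum.
    by rewrite !weval_letter.
  - apply/cE/sb; rewrite !mem_cat; case: v.
      by do ![apply/orP; right]; apply: (map_f (fun i => _)); rewrite mem_enum.
    apply/orP; right; apply/or3P; apply: Or32.
    by apply: (map_f (fun i => _)); rewrite mem_enum.
rewrite !mem_cat => /or4P[/mapP[s sin ->]|/allpairsP[[i j] [_ _ ->]]|/mapP[i _ ->]|/mapP[i _ ->]].
- by rewrite dE sb.
- by apply/weval_wcomm; rewrite !weval_letter.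
- by apply/cE; exact: (pb false i).
- by apply/cE; exact: (pb true i).
Qed.

Lemma weval_double (E : groupType) (b : I + I -> E) u :
    (forall i j, commute (b (inl i)) (b (inr j))) ->
  weval b u = weval (fun i => b (inl i)) (wsubst (proj false) u) *
              weval (fun i => b (inr i)) (wsubst (proj true) u).
Proof.
move=> cb; rewrite !weval_subst -weval_mul.
  apply: eq_weval => -[i|i];
  by rewrite /= weval_letter weval_nil ?mulg1 ?mul1g.
move=> [i|i] [j|j]; rewrite /= ?weval_letter ?weval_nil;
  by [exact: commute1 | exact: cb | apply/commute_sym/commute1].
Qed.

Lemma double_gen_proj u v :
  weval double_gen u = 1 -> weval a (wsubst (proj v) u) = 1.
Proof.
move=> u1; apply/ffunP => t; rewrite one_ffunE weval_ffunE weval_subst.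
rewrite -[RHS](one_ffunE G (v, t)) -u1 weval_ffunE; apply: eq_weval => x.
by case: x => i; rewrite ffunE /=; case: v => /=; rewrite ?weval_letter ?weval_nil.
Qed.

(** A word trivial in [G^T] is central in a half. Its commutators with this half
    also lie in the other half, so they are central, and they are trivial on the
    balanced words [c i], whose values are the generators. *)
Lemma double_central_half (E : groupType) (y z : I -> E) u :
    (forall i j, commute (y i) (z j)) ->
    (forall x, (forall i, commute x (y i)) -> (forall i, commute x (z i)) ->
      central x) ->
    satisfies rels (fun i => y i * z i) ->
    (forall i, weval y (c i) = y i) ->
    weval a u = 1 ->
  forall i, commute (weval y u) (y i).
Proof.
move=> cyz gen sd py u1 i.
have cyw (w w' : seq (I * bool)) : commute (weval y w) (weval z w').
  apply: subgroup_weval (commute_subgroup _) _ => j; apply: commute_sym.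
  by apply: subgroup_weval (commute_subgroup _) _ => k; apply: commute_sym.
set p := weval y u; set q := weval z u.
(* The word commutes with the products of both halves, so its commutators in the
   two halves are inverse to each other. *)
have cR w : [~ p, weval y w] = [~ weval z w, q].
  have := central_presents_commute_word ha sd w u1.
  by rewrite !weval_mul //; apply: commute_mul_commg => //; apply: cyw.
have cc w : central [~ p, weval y w].
  apply: gen => j; apply: commute_sym.
    rewrite cR -weval_commg -(weval_letter y); exact: cyw.
  by rewrite -weval_commg -(weval_letter z); apply/commute_sym/cyw.
apply/commgP/eqP; rewrite -(py i).
apply: (balanced_central (h := fun w => [~ p, weval y w])) (bc i) => [//|v w|j].
  rewrite weval_cat -commgV_eq central_commM; last first.
    by rewrite -commgV_eq; apply: (subgroupV (central_subgroup E)).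
  by rewrite -(commgV_eq p) -(commgV_eq p (weval y w)) invgM !invgK; apply: cc.
by rewrite !weval_cons !weval_nil /= !mulg1 !mulgV.
Qed.

Lemma weval_double_copy v w p :
  weval double_gen (wsubst (copy v) w) p = if p.1 == v then weval a w p.2 else 1.
Proof.
rewrite !weval_ffunE weval_copy; case: eqVneq => [<-|pv].
  by apply: eq_weval => i; case: p => -[] t; rewrite ffunE.
rewrite -(weval_one G w); apply: eq_weval => i.
by case: v p pv => -[[] t] //= _; rewrite ffunE.
Qed.

Lemma double_central_presents : central_presents double_rels double_gen.
Proof.
have [ga sa _ _] := ha.
split.
- move=> x; pose xv v : {ffun T -> G} := [ffun t => x (v, t)].
  have [w0 e0] := ga (xv false); have [w1 e1] := ga (xv true).
  exists (wsubst (copy false) w0 ++ wsubst (copy true) w1).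
  apply/ffunP => -[v t]; rewrite weval_cat mul_ffunE !weval_double_copy e0 e1.
  by case: v; rewrite !ffunE ?mulg1 ?mul1g.
- apply/double_relsP; split=> [r rin|i j|v i].
  + apply/ffunP => p; rewrite one_ffunE weval_ffunE.
    rewrite -[RHS](one_ffunE G p.2) -(sa r rin) weval_ffunE; apply: eq_weval => i.
    by rewrite mul_ffunE !ffunE; case: p.1; rewrite ?mulg1 ?mul1g.
  + apply/ffunP => p; rewrite !mul_ffunE !ffunE.
    by case: p.1; rewrite mulg1 mul1g.
  + have /weval_eq1 := ec i sa; rewrite weval_letter => e.
    rewrite -weval_copy; apply/ffunP => p; rewrite weval_double_copy -e.
    by case: p v => [[] t] []; rewrite ffunE.
- move=> u x u1; apply: entails_gen => E b gb /double_relsP[sd cb pb].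
  apply/weval_wcomm; rewrite weval_letter (weval_double _ cb).
  set y := fun i => b (inl i); set z := fun i => b (inr i).
  have gen h : (forall i, commute h (y i)) -> (forall i, commute h (z i)) -> central h.
    move=> hy hz g; have [w <-] := gb g.
    by apply: subgroup_weval (commute_subgroup _) _ => -[].
  have sd' : satisfies rels (fun i => z i * y i).
    by move=> r rin; rewrite -[RHS](sd r rin); apply: eq_weval => i; rewrite cb.
  have hy := double_central_half cb gen sd (pb false) (double_gen_proj false u1).
  have hz := double_central_half (fun i j => commute_sym (cb j i))
    (fun h hz hy => gen h hy hz) sd' (pb true) (double_gen_proj true u1).
  apply: commute_sym; case: x => i; apply: commuteM; apply: commute_sym => //.
    by apply: commute_sym; apply: subgroup_weval (commute_subgroup _) _ => j; exact: cb.
  apply: commute_sym; apply: subgroup_weval (commute_subgroup _) _ => j.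
  by apply: commute_sym; exact: cb.
- case=> i.
    exists (wsubst (copy false) (c i)); first exact: balanced_subst.
    move=> E b /double_relsP[_ _ pb]; apply/weval_eq1.
    by rewrite weval_copy (pb false) weval_letter.
  exists (wsubst (copy true) (c i)); first exact: balanced_subst.
  move=> E b /double_relsP[_ _ pb]; apply/weval_eq1.
  by rewrite weval_copy (pb true) weval_letter.
Qed.

End Doubling.

Lemma central_presents_double (T : finType) (G : groupType) (I : finType)
    (rels : seq (seq (I * bool))) (a : I -> {ffun T -> G}) :
  central_presents rels a ->
  exists (rels' : seq (seq ((I + I) * bool))) (a' : I + I -> {ffun bool * T -> G}),
    central_presents rels' a' /\
    size rels' = (size rels + #|I| ^ 2 + 2 * #|I|)%N.
Proof.
move=> ha; have [_ _ _ pa] := ha.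
have [c cP] := choice (fun i => let: ex_intro2 c bc ec := pa i in
  ex_intro (fun c => balanced c /\ entails rels (letter i ++ winv c)) c (conj bc ec)).
exists (double_rels rels c), (double_gen a); split; last exact: size_double_rels.
by apply: double_central_presents => // i; case: (cP i).
Qed.

(** A presentation with respect to other generators needs one more relator for
    each of them. *)
Lemma central_presents_change (I J : finType) (P : groupType)
    (rels : seq (seq (I * bool))) (a : I -> P) (a' : J -> P) :
    central_presents rels a -> wgenerates a' ->
  exists2 rels' : seq (seq (J * bool)), central_presents rels' a'
    & size rels' = (size rels + #|J|)%N.
Proof.
move=> ha ga'; have [ga sa _ pa] := ha.
have [w wE] := choice (fun i => ga' (a i)).
have [v vE] := choice (fun j => ga (a' j)).
have [c cP] := choice (fun i => let: ex_intro2 c bc ec := pa i in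
  ex_intro (fun c => balanced c /\ entails rels (letter i ++ winv c)) c (conj bc ec)).
pose rels' := map (wsubst w) rels ++
  [seq letter j ++ winv (wsubst w (v j)) | j <- enum J].
have relsP (E : groupType) (b : J -> E) : satisfies rels' b <->
    satisfies rels (fun i => weval b (w i)) /\
    forall j, weval (fun i => weval b (w i)) (v j) = b j.
  split=> [sb|[sb vb] r].
    split=> [r rin|j].
      by rewrite -weval_subst; apply: sb; rewrite mem_cat map_f.
    rewrite -weval_subst -[RHS](weval_letter b); apply/esym/weval_eq1/sb.
    rewrite mem_cat; apply/orP; right.
    by apply: (map_f (fun j => _)); rewrite mem_enum.
  rewrite mem_cat => /orP[/mapP[s sin ->]|/mapP[j _ ->]].
    by rewrite weval_subst sb.
  by apply/weval_eq1; rewrite weval_letter weval_subst vb.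
have awE u : weval (fun i => weval a' (w i)) u = weval a u.
  exact: eq_weval.
exists rels'; last by rewrite size_cat !size_map -?enumT -cardE.
split=> //.
- apply/relsP; split=> [r rin|j]; first by rewrite awE sa.
  by rewrite awE.
- move=> u j u1 E b /relsP[sb vb]; apply/weval_wcomm.
  pose b' i := weval b (w i).
  have -> : weval b u = weval b' (wsubst v u).
    by rewrite weval_subst; apply: eq_weval => k; rewrite vb.
  rewrite weval_letter -(vb j).
  apply: (central_presents_commute_word ha sb).
  by rewrite weval_subst -u1; apply: eq_weval.
- move=> j; exists (wsubst w (wsubst c (v j))).
    by apply: balanced_subst; apply: balanced_subst_in => i; case: (cP i).
  move=> E b /relsP[sb vb]; apply/weval_eq1.
  rewrite weval_letter !weval_subst -{1}(vb j); apply: eq_weval => i.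
  have [_ /(_ E _ sb)/weval_eq1] := cP i.
  by rewrite weval_letter.
Qed.

(** * From central presentations of powers to presentations *)

(** Every homomorphism from [G] to a central quotient of a group lifts. A map
    [s] that is a homomorphism modulo the centre stands for the former. *)
Definition lifting (G : groupType) : Prop :=
  forall (E : groupType) (s : G -> E),
    (forall x y, eqZ (s x * s y) (s (x * y))) ->
  exists2 f : G -> E, {morph f : x y / x * y} & forall x, eqZ (f x) (s x).

(** If the commutators of [y] with the image of a perfect group are central, they
    are trivial, as they form an abelian homomorphic image of the perfect group. *)
Lemma central_commute (G E : groupType) (f : G -> E) (y : E) :
    perfect G -> {morph f : x z / x * z} -> (forall x, central [~ f x, y]) ->
  forall x, commute (f x) y.
Proof.
move=> pG fM cf x; apply/commgP/eqP.
apply: (perfect_central pG (f := fun x => [~ f x, y])) => // u v.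
by rewrite fM central_commM.
Qed.

Section PowerHom.

Variables (T : finType) (G : groupType) (E : groupType) (f : T -> G -> E).
Hypothesis fM : forall t, {morph f t : x y / x * y}.

(** The map [G^T -> E] that restricts to [f t] on the factor [t]. *)
Definition power_hom (x : {ffun T -> G}) : E := \prod_(t <- enum T) f t (x t).

Lemma power_homM :
    (forall s t g h, s != t -> commute (f s g) (f t h)) ->
  {morph power_hom : x y / x * y}.
Proof.
move=> cf x y; rewrite /power_hom; elim: (enum T) (enum_uniq T) => [|t l IH] /=.
  by rewrite !big_nil mulg1.
move=> /andP[tl /IH {}IH]; rewrite !big_cons IH mul_ffunE fM -!mulgA.
congr (_ * _); rewrite !mulgA; congr (_ * _).
elim: l tl {IH} => [|s l IH]; first by rewrite big_nil mulg1 mul1g.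
rewrite inE negb_or big_cons => /andP[ts /IH {}IH].
by rewrite mulgA (cf _ _ _ _ ts) -!mulgA IH.
Qed.

Lemma power_hom_factor t g : power_hom (pinj (pred1 t) g) = f t g.
Proof.
rewrite /power_hom; have : t \in enum T by rewrite mem_enum.
elim: (enum T) (enum_uniq T) => //= s l IH /andP[sl ul].
rewrite inE big_cons ffunE /= eq_sym; case: eqVneq sl => [->|st] sl /=.
  move=> _; rewrite big1_seq ?mulg1 // => r /andP[_ rl].
  by rewrite ffunE /=; case: eqVneq rl sl => [-> ->|_ _ _] //; exact: hom1.
by rewrite (hom1 (fM s)) mul1g; exact: IH.
Qed.

End PowerHom.

Section Finish.

Variables (T : finType) (G : groupType) (I : choiceType).
Variables (rels : seq (seq (I * bool))) (a : I -> {ffun T -> G}).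
Hypotheses (pG : perfect G) (ha : central_presents rels a).

(** In a group generated by images of the letters that satisfy the relators, the
    words trivial in [G^T] are trivial as soon as each factor [G] of [G^T] lifts:
    the lifts of distinct factors commute modulo the centre, hence commute. *)
Lemma central_presents_factors (E : groupType) (b : I -> E) (f : T -> G -> E) :
    wgenerates b -> satisfies rels b ->
    (forall t, {morph f t : x y / x * y}) ->
    (forall t g, exists2 w, weval a w = pinj (pred1 t) g & eqZ (f t g) (weval b w)) ->
  forall u, weval a u = 1 -> weval b u = 1.
Proof.
move=> gb sb fM fw u u1.
have cf s t g h : s != t -> central [~ f s g, f t h].
  move=> st; have [[w wa wb] [v va vb]] := (fw s g, fw t h).
  apply: eqZ_central (eqZR wb vb) _; rewrite -weval_commg.
  apply: (central_presents_central ha) => //; rewrite weval_commg wa va.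
  apply/eqP/commgP/pinj_commute => r /eqP -> /eqP e.
  by rewrite e eqxx in st.
pose F := power_hom f.
have FM : {morph F : x y / x * y}.
  apply: power_homM => // s t g h st; apply: (central_commute pG (fM s)) => x.
  exact: cf.
have Fw x : exists2 w, weval a w = x & eqZ (F x) (weval b w).
  rewrite {1}[x]ffun_prod /F /power_hom; elim: (enum T) => [|t l [w wa wb]].
    by exists [::]; rewrite weval_nil !big_nil //; exact: eqZ_refl.
  have [v va vb] := fw t (x t).
  by exists (v ++ w); rewrite !big_cons weval_cat ?va ?wa //; exact: eqZM.
have FE w : eqZ (F (weval a w)) (weval b w).
  have [v va vb] := Fw (weval a w); apply: eqZ_trans vb _.
  exact: (central_presents_eqZ ha).
by rewrite -(central_presents_lift ha sb FM FE) u1 (hom1 FM).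
Qed.

(** The case where all the factors lift by the lifting property. *)
Lemma lifting_wpresents : lifting G -> wpresents rels a.
Proof.
move=> lG; have [ga sa _ _] := ha; split=> // u u1; apply: entails_gen => E b gb sb.
have [w wE] := choice ga.
have hf t : exists f : G -> E, {morph f : x y / x * y} /\
    forall x, eqZ (f x) (weval b (w (pinj (pred1 t) x))).
  have [x y|f fM fE] := lG E (fun x => weval b (w (pinj (pred1 t) x))).
    rewrite -weval_cat; apply: (central_presents_eqZ ha) => //.
    by rewrite weval_cat !wE pinjM.
  by exists f.
have [f fP] := choice hf.
apply: (central_presents_factors (f := f) gb sb) u1 => [t|t g].
  by case: (fP t).
by exists (w (pinj (pred1 t) g)) => //; case: (fP t).
Qed.

(** Without a lifting property, the relators of a presentation of [G] are imposed
    on each factor. *)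
Lemma factors_wpresents (J : finType) (relsG : seq (seq (J * bool))) (x : J -> G) :
    wpresents relsG x ->
  exists2 rels' : seq (seq (I * bool)), wpresents rels' a
    & size rels' = (size rels + #|T| * size relsG)%N.
Proof.
move=> hx; have [gx sx _] := hx; have [ga sa _ _] := ha; have [w wE] := choice ga.
pose v t j := w (pinj (pred1 t) (x j)).
have vE t u : weval a (wsubst (v t) u) = pinj (pred1 t) (weval x u).
  rewrite weval_subst (hom_weval (pinjM (pred1 t))).
  by apply: eq_weval => j; rewrite wE.
exists (rels ++ [seq wsubst (v t) r | t <- enum T, r <- relsG]); last first.
  by rewrite size_cat size_allpairs -cardE.
split=> // [r|u u1].
  rewrite mem_cat => /orP[/sa //|/allpairsP[[t s] [_ sin ->]]].
  by rewrite vE (sx s sin) (hom1 (pinjM _)).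
apply: entails_gen => E b gb sb'.
have sb : satisfies rels b by move=> r rin; apply: sb'; rewrite mem_cat rin.
have hf t : exists f : G -> E, {morph f : x y / x * y} /\
    forall j, f (x j) = weval b (v t j).
  have [r rin|f fM fE] := wpresents_hom hx (b := fun j => weval b (v t j)).
    rewrite -weval_subst; apply: sb'; rewrite mem_cat; apply/orP; right.
    by apply/allpairsP; exists (t, r); rewrite mem_enum.
  by exists f.
have [f fP] := choice hf.
apply: (central_presents_factors (f := f) gb sb) u1 => [t|t g].
  by case: (fP t).
have [q <-] := gx g; exists (wsubst (v t) q); first exact: vE.
have [fM fE] := fP t; rewrite (hom_weval fM) weval_subst (eq_weval _ fE).
exact: eqZ_refl.
Qed.

End Finish.

(** Killing the factors outside the image of [h]: by perfectness it suffices to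
    kill the diagonal of their product. *)
Lemma wpresents_subpower (S T : finType) (G : groupType) (h : S -> T) (I : choiceType)
    (rels : seq (seq (I * bool))) (a : I -> {ffun T -> G})
    (J : finType) (x : J -> G) :
    perfect G -> injective h -> wpresents rels a -> wgenerates x ->
  exists2 rels' : seq (seq (I * bool)),
    wpresents rels' (fun i => [ffun s => a i (h s)] : {ffun S -> G})
    & size rels' = (size rels + #|J|)%N.
Proof.
move=> pG hI ha gx; have [ga sa _] := ha; have [w wE] := choice ga.
(* The points [t] of [T] whose factor is killed. *)
pose K t := t \notin codom h; pose v j := w (pinj K (x j)).
pose res (y : {ffun T -> G}) : {ffun S -> G} := [ffun s => y (h s)].
have resM : {morph res : y z / y * z}.
  by move=> y z; apply/ffunP => s; rewrite mul_ffunE !ffunE.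
exists (rels ++ [seq v j | j <- enum J]); last first.
  by rewrite size_cat size_map -cardE.
have aE u : weval (fun i => res (a i)) u = res (weval a u).
  by rewrite (hom_weval resM).
split.
- move=> y; pose y' : {ffun T -> G} :=
    [ffun t => if [pick s | h s == t] is Some s then y s else 1].
  exists (w y'); rewrite aE wE; apply/ffunP => s; rewrite !ffunE.
  by case: pickP => [s' /eqP/hI -> //|/(_ s)]; rewrite eqxx.
- move=> r; rewrite mem_cat aE => /orP[/sa ->|/mapP[j _ ->]].
    exact: hom1 resM.
  apply/ffunP => s; rewrite wE !ffunE /K.
  by rewrite codom_f.
move=> u; rewrite aE => u1 E b sb'.
have sb : satisfies rels b by move=> r rin; apply: sb'; rewrite mem_cat rin.
have [f fM fE] := wpresents_hom ha sb.
have -> : weval b u = f (weval a u).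
  by rewrite (hom_weval fM); apply: eq_weval => i; rewrite fE.
(* The kernel contains the diagonal of the factors to be killed, hence its
   commutators with each of these factors, which generate it. *)
have fK g : f (pinj K g) = 1.
  have [q <-] := gx g; rewrite (hom_weval (pinjM K)) (hom_weval fM).
  rewrite -(weval_one E q); apply: eq_weval => j.
  rewrite -(wE (pinj K _)) (hom_weval fM) -[RHS](sb' (v j)).
    by apply: eq_weval => i; rewrite fE.
  by rewrite mem_cat; apply/orP; right; apply: map_f; rewrite mem_enum.
have fk t g : K t -> f (pinj (pred1 t) g) = 1.
  move=> Kt; apply: (perfect_subgroup (T := fun g => f (pinj (pred1 t) g) = 1)) => //.
    split=> [|y z fy fz|y fy]; first by rewrite !(hom1 (pinjM _), hom1 fM).
      by rewrite pinjM fM fy fz mulg1.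
    by rewrite (homV (pinjM _)) (homV fM) fy invg1.
  move=> y z; have <- : [~ pinj K y, pinj (pred1 t) z] = pinj (pred1 t) [~ y, z].
    rewrite commg_pinj; apply/ffunP => r; rewrite !ffunE /= andbC.
    by case: eqVneq => //= ->; rewrite Kt.
  by rewrite (homR fM) fK comm1g.
rewrite [weval a u]ffun_prod (big_morph f fM (hom1 fM)) big1 // => t _.
have [/fk ->//|] := boolP (K t); rewrite negbK => /codomP[s ->].
have := congr1 (fun y : {ffun S -> G} => y s) u1; rewrite ffunE one_ffunE => ->.
by rewrite (hom1 (pinjM _)) (hom1 fM).
Qed.

(** * Generators of direct powers *)

Lemma span_subgroup (I : Type) (G : groupType) (a : I -> G) :
  subgroup (fun x => exists w, weval a w = x).
Proof.
split=> [|x y [u <-] [v <-]|x [u <-]].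
- by exists [::]; exact: weval_nil.
- by exists (u ++ v); exact: weval_cat.
- by exists (winv u); exact: weval_winv.
Qed.

Lemma span_gen (I : Type) (G : groupType) (a : I -> G) i : exists w, weval a w = a i.
Proof. by exists (letter i); exact: weval_letter. Qed.

Section CubeGen.

Variables (T : finType) (G : groupType) (I J : Type).
Variables (a : I -> {ffun T -> G}) (x : J -> G).
Hypotheses (pG : perfect G) (ga : wgenerates a) (gx : wgenerates x).

(** The generators of [G^T], copied diagonally on the two halves, and the
    generators of [G] as constants on each half. *)
Definition cube_gen (z : I + bool * J) : {ffun bool * T -> G} :=
  match z with
  | inl i => [ffun p => a i p.2]
  | inr (v, j) => pinj (fun p => p.1 == v) (x j)
  end.

(** Two points of [bool * T] are separated by constants on a half if they lie in
    distinct halves, and by the diagonal copy of [G^T] otherwise. *)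
Lemma cube_gen_generates : wgenerates cube_gen.
Proof.
pose diag (y : {ffun T -> G}) : {ffun bool * T -> G} := [ffun p => y p.2].
have diagM : {morph diag : y z / y * z}.
  by move=> y z; apply/ffunP => p; rewrite mul_ffunE !ffunE.
have sH := span_subgroup cube_gen.
have Hd y : exists w, weval cube_gen w = diag y.
  have [w <-] := ga y; rewrite (hom_weval diagM).
  by apply: (subgroup_weval w sH) => i; exact: (span_gen cube_gen (inl i)).
have Hp v g : exists w, weval cube_gen w = pinj (fun p => p.1 == v) g.
  have [w <-] := gx g; rewrite (hom_weval (pinjM _)).
  by apply: (subgroup_weval w sH) => j; exact: (span_gen cube_gen (inr (v, j))).
apply: power_generation => // [p g|[v s] [v' t] g st].
  by exists (diag [ffun=> g]); [exact: Hd|rewrite !ffunE].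
have [vv|vv] := eqVneq v v'; last first.
  exists (pinj (fun p => p.1 == v) g); first exact: Hp.
  by rewrite !ffunE /= eqxx eq_sym (negPf vv).
exists (diag (pinj (pred1 s) g)); first exact: Hd.
rewrite !ffunE /= eqxx; split=> //; case: eqVneq => // e.
by rewrite vv e eqxx in st.
Qed.

End CubeGen.

Section InfiniteOrderGen.

Variables (T : finType) (G : groupType) (J : Type) (x : J -> G) (g : G).
Hypotheses (pG : perfect G) (gx : wgenerates x).
Hypothesis gP : infinite_order_in_quotients g.

(** If [g] has infinite order in every non-trivial quotient of [G], the normal
    closure of each [g^m g^-n], [m <> n], is [G]. *)
Lemma infinite_order_normal (N : G -> Prop) m n :
    subgroup N -> (forall y z, N y -> N (y ^ z)) -> m <> n ->
    N (g ^+ m * (g ^+ n)^-1) ->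
  forall y, N y.
Proof.
move=> sN nN mn Ng y; have [Q [f [fM fS fE]]] := normal_quotient sN nN.
apply/fE; apply: contrapT => fy.
pose F : {multiplicative G -> Q} := HB.pack f (isMultiplicative.Build G Q f fM).
have hF := gP (f := F) fS (ex_intro (fun z : Q => z <> 1) _ fy).
have fX k : f (g ^+ k) = f g ^+ k.
  by elim: k => [|k IH]; rewrite ?(hom1 fM) // !expgS fM IH.
move/fE: Ng; rewrite fM (homV fM) !fX => /divg1_eq e.
wlog lt_mn : m n e mn / (m < n)%N => [h|].
  have [lt|le] := ltnP m n; first exact: h lt.
  apply: (h n m) => //; first exact/nesym.
  by rewrite ltn_neqAle le andbT; apply/eqP/nesym.
apply: (hF (n - m)%N); first by rewrite subn_gt0.
by rewrite /= expgnFr 1?ltnW // -e mulgV.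
Qed.

(** The diagonal generators, and [(1, g, g^2, ...)] for an enumeration of [T]. *)
Definition infinite_order_gen (z : option J) : {ffun T -> G} :=
  if z is Some j then [ffun=> x j] else [ffun t => g ^+ (enum_rank t : nat)].

Lemma infinite_order_generates : wgenerates infinite_order_gen.
Proof.
set a := infinite_order_gen; have sH := span_subgroup a.
pose diag (h : G) : {ffun T -> G} := [ffun=> h].
have diagM : {morph diag : y z / y * z}.
  by move=> y z; apply/ffunP => p; rewrite mul_ffunE !ffunE.
have Hd h : exists w, weval a w = diag h.
  have [w <-] := gx h; rewrite (hom_weval diagM).
  by apply: (subgroup_weval w sH) => j; exact: (span_gen a (Some j)).
apply: power_generation => // [t h|s t h st].
  by exists (diag h); [exact: Hd|rewrite ffunE].
pose N u := exists2 y : {ffun T -> G}, exists w, weval a w = y & y s = u /\ y t = 1.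
apply: (@infinite_order_normal N (enum_rank s) (enum_rank t)) h.
- split=> [|y z [u Hu [<- ut]] [v Hv [<- vt]]|y [u Hu [<- ut]]].
  + by exists 1; [exact: (subgroup1 sH)|rewrite !one_ffunE].
  + by exists (u * v); [exact: (subgroupM sH)|rewrite !mul_ffunE ut vt mulg1].
  + by exists u^-1; [exact: (subgroupV sH)|rewrite !inv_ffunE ut invg1].
- move=> y z [u Hu [<- ut]]; exists (u ^ diag z).
    have Hz := Hd z.
    by rewrite /conjg; do ![apply: (subgroupM sH) => // | apply: (subgroupV sH) => //].
  by rewrite /conjg !mul_ffunE !inv_ffunE ut !ffunE mul1g mulVg.
- by move=> /ord_inj/enum_rank_inj e; rewrite e eqxx in st.
(* The value at [t] is 1, and the value at [s] is a power of [g] with a non-zero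
   exponent. *)
exists (a None * (diag (g ^+ enum_rank t))^-1).
  by apply: (subgroupM sH); [exact: span_gen|apply: (subgroupV sH); exact: Hd].
by rewrite !mul_ffunE !inv_ffunE !ffunE mulgV.
Qed.

End InfiniteOrderGen.

(** * Presentations of the powers of a perfect group *)

(** The set of [2^m] points that indexes the factors. *)
Fixpoint cube (m : nat) : finType :=
  if m is m'.+1 then (bool * cube m')%type else unit.

Lemma card_cube m : #|cube m| = (2 ^ m)%N.
Proof. by elim: m => [|m IH]; rewrite ?card_unit //= card_prod card_bool IH expnS. Qed.

Lemma ord_cube m n : (n <= 2 ^ m)%N -> exists h : 'I_n -> cube m, injective h.
Proof.
rewrite -card_cube => le; exists (fun i => enum_val (widen_ord le i)) => i j.
by move/enum_val_inj/(congr1 val) => /= /val_inj.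
Qed.

(** Iterated doubling, starting from a presentation of [G], where the generators of
    [G^(2^m)] are replaced by the family [a m] after each step. *)
Section Chain.

Variables (G : groupType) (J : finType) (relsG : seq (seq (J * bool))) (x : J -> G).
Hypotheses (pG : perfect G) (hx : wpresents relsG x).
Variables (I : nat -> finType) (a : forall m, I m -> {ffun cube m -> G}).
Hypothesis ga : forall m, wgenerates (@a m).

Lemma wpresents_unit :
  wpresents relsG (fun j => [ffun=> x j] : {ffun unit -> G}).
Proof.
have [gx sx ex] := hx; pose c (g : G) : {ffun unit -> G} := [ffun=> g].
have cM : {morph c : y z / y * z}.
  by move=> y z; apply/ffunP => p; rewrite mul_ffunE !ffunE.
have cE u : weval (fun j => c (x j)) u = c (weval x u) by rewrite (hom_weval cM).
split=> [y|r rin|u].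
- have [w wE] := gx (y tt); exists w; rewrite cE wE.
  by apply/ffunP => -[]; rewrite ffunE.
- by rewrite cE sx // (hom1 cM).
- rewrite cE => /(congr1 (fun y : {ffun unit -> G} => y tt)).
  by rewrite ffunE one_ffunE; exact: ex.
Qed.

Lemma cube_central_presents m K :
    (forall i, (i <= m)%N -> (#|I i| <= K)%N) ->
  exists2 rels : seq (seq (I m * bool)), central_presents rels (@a m)
    & (size rels <= size relsG + m.+1 * (K ^ 2 + 3 * K))%N.
Proof.
elim: m => [|m IH] hK.
  have h0 := wpresents_central (@perfect_power unit G pG) wpresents_unit.
  have [rels h e] := central_presents_change h0 (@ga 0).
  exists rels => //; rewrite e leq_add2l mul1n.
  by have := hK 0%N isT; nia.
have [|rels h le] := IH; first by move=> i im; apply: hK; exact: leqW.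
have [rels' [a' [h' e']]] := central_presents_double h.
have [rels2 h2 e2] := central_presents_change h' (@ga m.+1).
exists rels2 => //; rewrite e2 e'.
have := hK m (leqnSn m); have := hK m.+1 (leqnn _); nia.
Qed.

Lemma lifting_power_presentation m n K r :
    lifting G -> (n <= 2 ^ m)%N ->
    (forall i, (i <= m)%N -> (#|I i| <= K)%N) ->
    (size relsG + m.+1 * (K ^ 2 + 3 * K) + #|J| <= r)%N ->
  has_presentation (power G n) #|I m| r.
Proof.
move=> lG /ord_cube[h hI] /cube_central_presents[rels hr le] ler.
have hp := lifting_wpresents pG hr lG.
have [gx _ _] := hx; have [rels' h' e'] := wpresents_subpower pG hI hp gx.
by apply: has_presentation_finType h' _; rewrite e'; apply: leq_trans ler; rewrite leq_add2r.
Qed.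

Lemma perfect_power_presentation m n K r :
    (n <= 2 ^ m)%N -> (forall i, (i <= m)%N -> (#|I i| <= K)%N) ->
    (size relsG + m.+1 * (K ^ 2 + 3 * K) + 2 ^ m * size relsG + #|J| <= r)%N ->
  has_presentation (power G n) #|I m| r.
Proof.
move=> /ord_cube[h hI] /cube_central_presents[rels hr le] ler.
have [rels1 hp e1] := factors_wpresents pG hr hx.
have [gx _ _] := hx; have [rels' h' e'] := wpresents_subpower pG hI hp gx.
by apply: has_presentation_finType h' _; rewrite e' e1 card_cube; apply: leq_trans ler; rewrite !leq_add2r.
Qed.

End Chain.

(** An alphabet of size linear in [m], and the corresponding generators of
    [G^(2^m)]. *)
Fixpoint cube_index (J : finType) (m : nat) : finType :=
  if m is m'.+1 then (cube_index J m' + bool * J)%type else J.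

Lemma card_cube_index (J : finType) m : #|cube_index J m| = (#|J| * (2 * m).+1)%N.
Proof.
elim: m => [|m IH]; first by rewrite muln0 muln1.
rewrite /= card_sum card_prod card_bool IH (mulnC 2%N #|J|) -mulnDr; congr (_ * _)%N; lia.
Qed.

Fixpoint cube_gens (J : finType) (G : groupType) (x : J -> G) m :
    cube_index J m -> {ffun cube m -> G} :=
  if m is m'.+1 then cube_gen (@cube_gens J G x m') x else fun j => [ffun=> x j].

Lemma cube_gens_generate (J : finType) (G : groupType) (x : J -> G) m :
  perfect G -> wgenerates x -> wgenerates (@cube_gens J G x m).
Proof.
move=> pG gx; elim: m => [|m IH] /=; last exact: cube_gen_generates.
pose c (g : G) : {ffun unit -> G} := [ffun=> g].
have cM : {morph c : y z / y * z}.
  by move=> y z; apply/ffunP => p; rewrite mul_ffunE !ffunE.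
move=> y; have [w wE] := gx (y tt); exists w.
by rewrite -(hom_weval cM) wE; apply/ffunP => -[]; rewrite ffunE.
Qed.

(** * Identities in abelian groups *)

(** Formal integral combinations, to decide the identities valid in all abelian
    groups by comparing coefficients. *)
Inductive zexpr :=
  | ZVar of nat | ZZero | ZAdd of zexpr & zexpr | ZOpp of zexpr.

Fixpoint zeval (A : zmodType) (env : seq A) (e : zexpr) : A :=
  match e with
  | ZVar i => nth 0 env i
  | ZZero => 0
  | ZAdd e1 e2 => zeval env e1 + zeval env e2
  | ZOpp e1 => - zeval env e1
  end%R.

Fixpoint zcoeff (e : zexpr) (i : nat) : int :=
  match e with
  | ZVar j => (i == j)%:R
  | ZZero => 0
  | ZAdd e1 e2 => zcoeff e1 i + zcoeff e2 i
  | ZOpp e1 => - zcoeff e1 i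
  end%R.

Lemma zeval_sum (A : zmodType) (env : seq A) e :
  zeval env e = (\sum_(i < size env) env`_i *~ zcoeff e i)%R.
Proof.
elim: e => [j||e1 IH1 e2 IH2|e1 IH1] /=.
- have [lt|ge] := ltnP j (size env); last first.
    rewrite nth_default // big1 // => i _.
    by rewrite (ltn_eqF (leq_trans (ltn_ord i) ge)) mulr0z.
  rewrite (bigD1 (Ordinal lt)) //= eqxx mulr1z big1 ?addr0 // => i ij.
  by rewrite (negPf ij : (i : nat) == j = false) mulr0z.
- by rewrite big1 // => i _; rewrite mulr0z.
- by rewrite IH1 IH2 -big_split; apply: eq_bigr => i _; rewrite mulrzDr.
- by rewrite IH1 -sumrN; apply: eq_bigr => i _; rewrite mulrNz.
Qed.

Lemma zeval_eq (A : zmodType) (env : seq A) e1 e2 :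
  all (fun i => zcoeff e1 i == zcoeff e2 i) (iota 0 (size env)) ->
  zeval env e1 = zeval env e2.
Proof.
move/allP => h; rewrite !zeval_sum; apply: eq_bigr => i _.
have /h/eqP -> // : (i : nat) \in iota 0 (size env).
by rewrite mem_iota add0n ltn_ord.
Qed.

Ltac zmod_index x env :=
  match env with
  | x :: _ => constr:(0%N)
  | _ :: ?env' => let n := zmod_index x env' in constr:(S n)
  end.

Ltac zmod_atoms env e :=
  match e with
  | (?x + ?y)%R => let env' := zmod_atoms env x in zmod_atoms env' y
  | (- ?x)%R => zmod_atoms env x
  | 0%R => env
  | _ => match env with
         | _ => let n := zmod_index e env in env
         | _ => constr:(e :: env)
         end
  end.

Ltac zmod_reify env e :=
  match e with
  | (?x + ?y)%R => let a := zmod_reify env x in let b := zmod_reify env y in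
                   constr:(ZAdd a b)
  | (- ?x)%R => let a := zmod_reify env x in constr:(ZOpp a)
  | 0%R => constr:(ZZero)
  | _ => let n := zmod_index e env in constr:(ZVar n)
  end.

(** Proves an identity that holds in every abelian group. *)
Ltac zmod :=
  match goal with
  | |- @eq ?T ?x ?y =>
    let env := zmod_atoms (@nil T) x in
    let env' := zmod_atoms env y in
    let a := zmod_reify env' x in
    let b := zmod_reify env' y in
    exact (@zeval_eq _ env' a b (erefl true))
  end.

Local Open Scope ring_scope.

(** * Subgroups of abelian groups *)

(** Subgroups of an abelian group, as predicates. *)
Record zsubgroup (V : zmodType) (S : V -> Prop) : Prop := ZSubgroup {
  zsub0 : S 0;
  zsubD : forall x y, S x -> S y -> S (x + y);
  zsubN : forall x, S x -> S (- x) }.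

Section ZSubgroup.

Variables (V : zmodType) (S : V -> Prop) (sS : zsubgroup S).

Lemma zsubB x y : S x -> S y -> S (x - y).
Proof. by move=> h k; apply: (zsubD sS) => //; apply: (zsubN sS). Qed.

Lemma zsubMz x (m : int) : S x -> S (x *~ m).
Proof.
move=> h; have hn n : S (x *+ n).
  elim: n => [|n IH]; first exact: zsub0.
  by rewrite mulrS; apply: (zsubD sS).
by case: m => n; rewrite ?NegzE ?mulrNz -pmulrn //; apply: (zsubN sS).
Qed.

(** The subgroup generated by [S] and [a]. *)
Definition zadjoin (a v : V) : Prop := exists m : int, S (v - a *~ m).

Lemma zadjoin_subgroup a : zsubgroup (zadjoin a).
Proof.
split=> [|x y [m hm] [n hn]|x [m hm]].
- by exists 0; rewrite mulr0z subr0; exact: zsub0.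
- exists (m + n); have -> : x + y - a *~ (m + n) = (x - a *~ m) + (y - a *~ n).
    rewrite mulrzDr; zmod.
  exact: (zsubD sS).
- exists (- m); have -> : - x - a *~ (- m) = - (x - a *~ m).
    rewrite mulrNz; zmod.
  exact: (zsubN sS).
Qed.

Lemma zadjoin_sub a v : S v -> zadjoin a v.
Proof. by exists 0; rewrite mulr0z subr0. Qed.

Lemma zadjoin_gen a : zadjoin a a.
Proof. by exists 1; rewrite mulr1z subrr; exact: zsub0. Qed.

End ZSubgroup.

(** The subgroup generated by [S] and the elements of [l]. *)
Fixpoint zspan (V : zmodType) (S : V -> Prop) (l : seq V) : V -> Prop :=
  if l is a :: l' then zspan (zadjoin S a) l' else S.

Lemma Fp_intr_eq0 p (m : int) : prime p -> ((p%:Z %| m)%Z) -> m%:~R = 0 :> 'F_p.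
Proof.
move=> pp /dvdzP[q ->]; rewrite intrM /=.
by rewrite -pmulrn pchar_Fp_0 ?mulr0.
Qed.

Section ZSpan.

Variable V : zmodType.
Implicit Types (S : V -> Prop) (l : seq V).

Lemma zspan_subgroup S l : zsubgroup S -> zsubgroup (zspan S l).
Proof. by elim: l S => //= a l IH S sS; apply/IH/zadjoin_subgroup. Qed.

Lemma zspan_sub S l v : zsubgroup S -> S v -> zspan S l v.
Proof.
elim: l S => //= a l IH S sS Sv.
by apply: IH; [exact: zadjoin_subgroup|exact: zadjoin_sub].
Qed.

Lemma zspan_gen S l v : zsubgroup S -> v \in l -> zspan S l v.
Proof.
elim: l S => //= a l IH S sS; rewrite inE => /orP[/eqP ->|vl].
  by apply: zspan_sub; [exact: zadjoin_subgroup|exact: zadjoin_gen].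
by apply: IH => //; exact: zadjoin_subgroup.
Qed.

(** A non-zero finitely generated abelian group [V / S] has a quotient of prime
    order: one removes generators until the quotient is cyclic. *)
Lemma zspan_character S l :
    zsubgroup S -> (forall v, zspan S l v) -> (exists v, ~ S v) ->
  exists p, prime p /\ exists f : V -> 'F_p,
    [/\ {morph f : x y / x + y}, forall v, S v -> f v = 0 & exists v, f v <> 0].
Proof.
elim: l S => [|a l IH] S sS /= full [v0 nv0]; first by case: nv0; exact: full.
have sS' := zadjoin_subgroup sS a.
have [hex|hall] := pselect (exists v, ~ zadjoin S a v).
  have [p [pp [f [fD f0 fn]]]] := IH _ sS' full hex.
  exists p; split=> //; exists f; split=> // v Sv.
  by apply/f0/zadjoin_sub.
have {}hall v : zadjoin S a v by apply: contrapT => nv; apply: hall; exists v.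
have nSa : ~ S a.
  move=> Sa; apply: nv0; have [m hm] := hall v0.
  by rewrite -[v0](subrK (a *~ m)); apply: (zsubD sS) => //; exact: zsubMz.
(* The relations of the cyclic quotient are the multiples of the order of [a], if
   this is finite, and 0 otherwise, so some prime divides them all. *)
have [p pp pI] : exists2 p, prime p & forall m : int, S (a *~ m) -> (p%:Z %| m)%Z.
  have [hex|hno] := pselect (exists n, (0 < n)%N && `[< S (a *+ n) >]); last first.
    exists 2%N => // m Sm; have [->|m0] := eqVneq m 0; first exact: dvdz0.
    case: hno; exists `|m|%N; rewrite absz_gt0 m0 /=; apply/asboolP.
    case: m {m0} Sm => n //=; rewrite NegzE mulrNz -pmulrn => /(zsubN sS).
    by rewrite opprK.
  have [n /andP[n0 /asboolP Sn] minn] := ex_minnP hex.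
  have n1 : n != 1%N by apply: contra_notN nSa => /eqP n1; rewrite n1 in Sn.
  exists (pdiv n); first by rewrite pdiv_prime // ltn_neqAle eq_sym n1.
  move=> m Sm; apply: (@dvdz_trans n%:Z); first exact: pdiv_dvd.
  have Sr : S (a *~ (m %% n)%Z).
    have -> : (m %% n)%Z = m - (m %/ n)%Z * n by rewrite {2}(divz_eq m n) addrC addKr.
    by rewrite mulrzBr; apply: (zsubB sS) => //; rewrite mulrC mulrzA; exact: zsubMz.
  have rn : ((m %% n)%Z < n)%R by rewrite ltz_pmod.
  apply/dvdz_mod0P; move: Sr rn (modz_ge0 m (lt0n_neq0 n0 : n%:Z != 0)).
  case: (m %% n)%Z => // [[|r]] // Sr rn _.
  by have := minn r.+1; rewrite /= asboolT // => /(_ isT); rewrite leqNgt -ltz_nat rn.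
exists p; split=> //.
have [m hm] := choice hall.
have mE v k : S (v - a *~ k) -> (m v)%:~R = k%:~R :> 'F_p.
  move=> h; apply/eqP; rewrite -subr_eq0 -intrB; apply/eqP/Fp_intr_eq0 => //.
  apply: pI; have -> : a *~ (m v - k) = (v - a *~ k) - (v - a *~ m v).
    rewrite mulrzBr; zmod.
  exact: zsubB.
exists (fun v => (m v)%:~R); split=> [x y|v Sv|].
- rewrite -intrD; apply: mE.
  have -> : x + y - a *~ (m x + m y) = (x - a *~ m x) + (y - a *~ m y).
    rewrite mulrzDr; zmod.
  exact: (zsubD sS).
- by rewrite (mE v 0) // mulr0z subr0.
- exists a; rewrite (mE a 1); last by rewrite mulr1z subrr; exact: zsub0.
  by apply/eqP; exact: oner_neq0.
Qed.

End ZSpan.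

Local Close Scope group_scope.

(** * Homology in degrees 1 and 2 *)

(** The additive extension of a function on a basis. *)
Definition flift (K : choiceType) (A : zmodType) (f : K -> A) :
    {freeg K / int} -> A := fglift (f : K -> zmodule A).

Section Fglift.

Variables (K : choiceType) (M : lmodType int) (f : K -> M).

Lemma fgliftB : {morph fglift f : x y / x - y}.
Proof. exact: lift_is_additive. Qed.

Lemma fglift0 : fglift f 0 = 0.
Proof. by rewrite -[X in fglift f X](subrr 0) fgliftB subrr. Qed.

Lemma fgliftN : {morph fglift f : x / - x}.
Proof. by move=> x; rewrite -[- x]sub0r fgliftB fglift0 sub0r. Qed.

Lemma fgliftD : {morph fglift f : x y / x + y}.
Proof. by move=> x y; rewrite -{1}[y]opprK fgliftB fgliftN opprK. Qed.

End Fglift.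

Section Flift.

Variables (K : choiceType) (A : zmodType) (f : K -> A).

Lemma fliftD : {morph flift f : x y / x + y}.
Proof. exact: (@fgliftD K (zmodule A) f). Qed.

Lemma fliftN : {morph flift f : x / - x}.
Proof. exact: (@fgliftN K (zmodule A) f). Qed.

Lemma flift0 : flift f 0 = 0.
Proof. exact: (@fglift0 K (zmodule A) f). Qed.

Lemma fliftB : {morph flift f : x y / x - y}.
Proof. exact: (@fgliftB K (zmodule A) f). Qed.

Lemma fliftU x : flift f << x >> = f x.
Proof. by rewrite /flift liftU scale1r. Qed.

End Flift.

Lemma freeg_subgroup (K : choiceType) (H : {freeg K / int} -> Prop) :
  zsubgroup H -> (forall x, H << x >>) -> forall D, H D.
Proof.
move=> sH Hx D; rewrite -[D]freeg_sumE; elim/big_ind: _ => [|u v|x _].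
- exact: zsub0.
- exact: zsubD.
- by rewrite -[coeff _ _]intz -freegU_mulz; exact: zsubMz.
Qed.

Lemma eq_freeg_additive (K : choiceType) (A : zmodType) (f g : {freeg K / int} -> A) :
    {morph f : x y / x + y} -> {morph g : x y / x + y} ->
  (forall x, f << x >> = g << x >>) -> f =1 g.
Proof.
move=> fD gD e; have zero (h : {freeg K / int} -> A) :
    {morph h : x y / x + y} -> h 0 = 0.
  by move=> hD; apply: (addrI (h 0)); rewrite -hD !addr0.
have opp (h : {freeg K / int} -> A) x : {morph h : x y / x + y} -> h (- x) = - h x.
  by move=> hD; apply: (addrI (h x)); rewrite -hD !subrr zero.
apply: freeg_subgroup => // ; split=> [|x y ex ey|x ex].
- by rewrite !zero.
- by rewrite fD gD ex ey.
- by rewrite !opp // ex.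
Qed.

Section BarComplex.

Variable G : groupType.
Implicit Types x y z : G.

(** The basis elements [[x]], [[x|y]] and [[x|y|z]] of the bar complex. *)
Definition cell1 x : bar_chain G 1 := << [tuple x] >>.
Definition cell2 x y : bar_chain G 2 := << [tuple x; y] >>.
Definition cell3 x y z : bar_chain G 3 := << [tuple x; y; z] >>.

Lemma cell1P (t : 1.-tuple G) : << t >> = cell1 (tnth t 0) :> bar_chain G 1.
Proof.
by congr (<< _ >>); apply/eq_from_tnth => i; rewrite [i]ord1.
Qed.

Lemma cell2P (t : 2.-tuple G) :
  << t >> = cell2 (tnth t 0) (tnth t 1) :> bar_chain G 2.
Proof.
congr (<< _ >>); apply/eq_from_tnth => i.
by case: i => [[|[|//]] lt]; rewrite [in RHS](tnth_nth 1%g) /=; congr (tnth t _);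
  apply/val_inj.
Qed.

Lemma cell3P (t : 3.-tuple G) :
  << t >> = cell3 (tnth t 0) (tnth t 1) (tnth t 2%:R) :> bar_chain G 3.
Proof.
congr (<< _ >>); apply/eq_from_tnth => i.
by case: i => [[|[|[|//]]] lt]; rewrite [in RHS](tnth_nth 1%g) /=; congr (tnth t _);
  apply/val_inj.
Qed.

Lemma boundaryD n : {morph @bar_boundary G n : c d / c + d}.
Proof. exact: fgliftD. Qed.

Lemma boundaryN n : {morph @bar_boundary G n : c / - c}.
Proof. exact: fgliftN. Qed.

Lemma boundaryU n (t : n.+1.-tuple G) :
  bar_boundary << t >> = \sum_(i < n.+2) (-1) ^+ i *: << bar_face i t >>.
Proof. by rewrite /bar_boundary liftU scale1r. Qed.

Lemma boundary1 (c : bar_chain G 1) : bar_boundary c = 0.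
Proof.
apply: (eq_freeg_additive (g := fun=> 0)) c => [|x y|t]; first exact: boundaryD.
  by rewrite addr0.
rewrite boundaryU !big_ord_recl big_ord0 addr0 /= scale1r expr1 scaleN1r.
by rewrite !(tuple0 (bar_face _ _)) subrr.
Qed.

Lemma boundary2 x y : bar_boundary (cell2 x y) = cell1 y - cell1 (x * y)%g + cell1 x.
Proof.
rewrite boundaryU !big_ord_recl big_ord0 addr0 /=.
rewrite /bump /= expr0 expr1 sqrrN expr1n !scale1r scaleN1r addrA.
by congr (_ - _ + _); congr (<< _ >>); apply/eq_from_tnth => j;
  rewrite tnth_mktuple [j]ord1 /= !(tnth_nth 1%g).
Qed.

Lemma boundary3 x y z : bar_boundary (cell3 x y z) =
  cell2 y z - cell2 (x * y)%g z + cell2 x (y * z)%g - cell2 x y.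
Proof.
rewrite boundaryU !big_ord_recl big_ord0 addr0 /=.
rewrite /bump /= expr0 expr1 [_ ^+ (1 + (1 + (1 + 0)))]exprS sqrrN expr1n mulr1.
rewrite !scale1r !scaleN1r !addrA.
by congr (_ - _ + _ - _); congr (<< _ >>); apply/eq_from_tnth => j;
  rewrite tnth_mktuple !(tnth_nth 1%g); case: j => [[|[|//]] lt] /=.
Qed.

End BarComplex.

(** * Consequences of the vanishing of homology *)

(** 2-cocycles and 2-coboundaries, for the trivial action. *)
Definition cocycle (G : groupType) (A : zmodType) (z : G -> G -> A) : Prop :=
  forall x y w, z y w - z (x * y)%g w + z x (y * w)%g - z x y = 0.

Definition coboundary (G : groupType) (A : zmodType) (z : G -> G -> A) : Prop :=
  exists f : G -> A, forall x y, z x y = f x + f y - f (x * y)%g.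

Section Vanishing.

Variable G : groupType.

Lemma H1_perfect : homology_vanishes G 1 -> perfect G.
Proof.
move=> h1 A f fM x; pose F := flift (fun t : 1.-tuple G => f (tnth t 0)).
have F0 b : F (bar_boundary b) = 0.
  apply: (eq_freeg_additive (f := F \o @bar_boundary G 1) (g := fun=> 0)) b
    => [c d|c d|t] /=.
  - by rewrite boundaryD; exact: fliftD.
  - by rewrite addr0.
  - rewrite cell2P boundary2 /F fliftD fliftB !fliftU !(tnth_nth 1%g) /= fM.
    zmod.
have [b eb] := h1 (cell1 x) (boundary1 _).
by rewrite -(F0 b) eb /F fliftU (tnth_nth 1%g).
Qed.

(** A chain with a given boundary, when the first homology vanishes. *)
Lemma boundary_section : homology_vanishes G 1 ->
  exists k : bar_chain G 1 -> bar_chain G 2,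
    {morph k : x y / x + y} /\ forall c, bar_boundary (k c) = c.
Proof.
move=> h1; have [c cE] := choice (fun x => h1 (cell1 x) (boundary1 _)).
pose k := flift (fun t : 1.-tuple G => c (tnth t 0)); exists k.
split; first exact: fliftD.
apply: (eq_freeg_additive (f := @bar_boundary G 1 \o k) (g := id)) => // [x y|t] /=.
  by rewrite [k _]fliftD boundaryD.
by rewrite /k fliftU cE cell1P.
Qed.

Section CocycleChain.

Variables (A : zmodType) (z : G -> G -> A).

(** The additive function on chains that extends [z]. *)
Definition cochain : bar_chain G 2 -> A :=
  flift (fun t : 2.-tuple G => z (tnth t 0) (tnth t 1)).

Lemma cochainD : {morph cochain : c d / c + d}.
Proof. exact: fliftD. Qed.

Lemma cochainB : {morph cochain : c d / c - d}.
Proof. exact: fliftB. Qed.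

Lemma cochainU x y : cochain (cell2 x y) = z x y.
Proof. by rewrite /cochain fliftU !(tnth_nth 1%g). Qed.

Lemma cochain_boundary : cocycle z -> forall b, cochain (bar_boundary b) = 0.
Proof.
move=> zc; apply: (eq_freeg_additive (f := cochain \o @bar_boundary G 2)
    (g := fun=> 0)) => [c d|c d|t] /=.
- by rewrite boundaryD cochainD.
- by rewrite addr0.
- by rewrite cell3P boundary3 !(cochainB, cochainD) !cochainU zc.
Qed.

End CocycleChain.

(** If [k] is a section of the boundary on 1-chains, the chain
    [[x|y] - k[x] - k[y] + k[xy]] is a cycle, hence a boundary, on which the cocycle
    vanishes. *)
Lemma H2_coboundary (A : zmodType) (z : G -> G -> A) :
  homology_vanishes G 1 -> homology_vanishes G 2 -> cocycle z -> coboundary z.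
Proof.
move=> /boundary_section[k [kD kE]] h2 zc.
exists (fun x => cochain z (k (cell1 x))) => x y.
pose c := cell2 x y - k (cell1 x) - k (cell1 y) + k (cell1 (x * y)%g).
have [b eb] : exists b, bar_boundary b = c.
  apply: h2; rewrite /= !(boundaryD, boundaryN) !kE boundary2; zmod.
have := cochain_boundary zc b; rewrite eb !(cochainB, cochainD) cochainU => e.
apply/eqP; rewrite -subr_eq0 -[X in _ == X]e; apply/eqP; zmod.
Qed.

(** The failure of a lift to be multiplicative is a cocycle with values in the
    centre; a function of which it is the coboundary corrects the lift. *)
Lemma H2_lifting :
  homology_vanishes G 1 -> homology_vanishes G 2 -> lifting G.
Proof.
move=> h1 h2 E s hs.
pose z x y := centre_of (hs x y).
have valz x y : (s x * s y = val (z x y) * s (x * y))%g by rewrite mulgVK.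
have zc : cocycle z.
  move=> x y w; have e : z x y + z (x * y)%g w = z y w + z x (y * w)%g.
    apply/val_inj; rewrite !val_centreD; apply: (mulIg (s (x * y * w)%g)).
    transitivity (s x * s y * s w)%g.
      by rewrite -mulgA -valz mulgA -valz.
    rewrite -mulgA valz mulgA -(centre_central (z y w)) -mulgA valz !mulgA.
    by rewrite -mulgA.
  transitivity (z y w + z x (y * w)%g - (z x y + z (x * y)%g w)); first zmod.
  by rewrite e subrr.
have [f fE] := H2_coboundary h1 h2 zc.
exists (fun x => (val (- f x) * s x)%g) => [x y|x]; last first.
  by rewrite /eqZ mulgK; exact: centre_central.
have -> : (val (- f x) * s x * (val (- f y) * s y) =
           val (- f x) * val (- f y) * (s x * s y))%g.
  by rewrite -!mulgA; congr (_ * _)%g; rewrite !mulgA (centre_central (- f y)).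
rewrite valz mulgA -!val_centreD; congr (_ * _)%g; congr val; rewrite fE; zmod.
Qed.

End Vanishing.

(** * Non-vanishing homology is detected by finite prime fields *)

Section Detect.

Variables (G : groupType) (k : nat).

(** The group [H_1(G)], generated by the classes of the [[a i]], has a quotient of
    prime order if it is not trivial. *)
Lemma H1_character (a : 'I_k -> G) :
    generates a -> ~ homology_vanishes G 1 ->
  exists p, prime p /\ exists f : G -> 'F_p,
    {morph f : x y / (x * y)%g >-> x + y} /\ exists x, f x <> 0.
Proof.
move=> ga nh1; pose S c := exists b : bar_chain G 2, bar_boundary b = c.
have sS : zsubgroup S.
  split=> [|_ _ [b <-] [d <-]|_ [b <-]].
  - by exists 0; rewrite [bar_boundary 0]fglift0.
  - by exists (b + d); exact: boundaryD.
  - by exists (- b); exact: boundaryN.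
pose l := [seq cell1 (a i) | i <- enum 'I_k].
have sl := zspan_subgroup l sS; pose U := zspan S l.
have UB x y : U (cell1 y - cell1 (x * y)%g + cell1 x).
  by apply: zspan_sub sS _; exists (cell2 x y); exact: boundary2.
have U1 : U (cell1 1%g).
  by have := UB 1%g 1%g; rewrite mulg1 subrr add0r.
have UM x y : U (cell1 x) -> U (cell1 y) -> U (cell1 (x * y)%g).
  move=> hx hy; have -> : cell1 (x * y)%g = cell1 x + cell1 y -
    (cell1 y - cell1 (x * y)%g + cell1 x) by zmod.
  by apply: (zsubB sl); [exact: (zsubD sl)|exact: UB].
have UV x : U (cell1 x) -> U (cell1 x^-1%g).
  move=> hx; have -> : cell1 x^-1%g = (cell1 x^-1%g - cell1 (x * x^-1)%g + cell1 x)
    - cell1 x + cell1 (x * x^-1)%g by zmod.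
  apply: (zsubD sl); last by rewrite mulgV.
  by apply: (zsubB sl); [exact: UB|].
have full c : U c.
  move: c; apply: freeg_subgroup => // t; rewrite cell1P.
  have [w <-] := ga (tnth t 0).
  apply: (subgroup_weval (H := fun x => U (cell1 x)) w) => // i.
  by apply: zspan_gen => //; apply: map_f; rewrite mem_enum.
have hex : exists c, ~ S c.
  by apply: contrapT => h; apply: nh1 => c _; apply: contrapT => h'; apply: h; exists c.
have [p [pp [f [fD f0 [c fc]]]]] := zspan_character sS full hex.
exists p; split=> //; exists (fun x => f (cell1 x)).
have fN x : f (- x) = - f x.
  by apply/eqP; rewrite -addr_eq0 -fD addNr f0 //; exact: (zsub0 sS).
split=> [x y|].
  have := f0 _ (ex_intro _ (cell2 x y) (boundary2 x y)); rewrite !fD fN => e.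
  by apply/eqP; rewrite -subr_eq0 -oppr_eq0 -[X in _ == X]e; apply/eqP; zmod.
apply: contrapT => h; apply: fc.
apply: (eq_freeg_additive (g := fun=> 0)) c => // [x y|t]; first by rewrite addr0.
by rewrite cell1P; apply: contrapT => h'; apply: h; exists (tnth t 0).
Qed.

End Detect.

(** * Cocycles and relators *)

Section Holonomy.

Variables (G : groupType) (A : zmodType) (z : G -> G -> A) (k : nat).
Variables (a : 'I_k -> G).

(** The value of a letter in [G]. *)
Definition letter_value (l : 'I_k * bool) : G := if l.2 then (a l.1)^-1%g else a l.1.

(** A 2-cocycle [z] defines a central extension of [G] by [A], with product
    [(x, c) (y, d) = (xy, c + d + z x y)] and identity [(1, - z 1 1)]. The holonomy
    of a word is the second coordinate of its value at the lifts [(a i, 0)] of the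
    generators. *)
Definition letter_holonomy (l : 'I_k * bool) : A :=
  if l.2 then - z 1%g 1%g - z (a l.1) (a l.1)^-1%g else 0.

Fixpoint holonomy (w : word k) : A :=
  if w is l :: w' then
    letter_holonomy l + holonomy w' + z (letter_value l) (weval a w')
  else - z 1%g 1%g.

(** The cocycle condition is only assumed modulo a subgroup [U], and all results
    hold modulo [U]. *)
Variables (U : A -> Prop) (sU : zsubgroup U).
Hypothesis zU : forall x y w, U (z y w - z (x * y)%g w + z x (y * w)%g - z x y).

Lemma holonomy_1l w : U (z 1%g w - z 1%g 1%g).
Proof.
have := zU 1%g 1%g w; rewrite !mul1g.
by have -> : forall p q : A, p - p + p - q = p - q by move=> p q; zmod.
Qed.

Lemma holonomy_1r w : U (z w 1%g - z 1%g 1%g).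
Proof.
have := zsubN sU (zU w 1%g 1%g); rewrite !mulg1.
by have -> : forall p q : A, - (p - q + q - q) = q - p by move=> p q; zmod.
Qed.

Lemma holonomy_cat u v :
  U (holonomy (u ++ v) - (holonomy u + holonomy v + z (weval a u) (weval a v))).
Proof.
elim: u => [|l u IH] /=.
  have -> : holonomy v - (- z 1%g 1%g + holonomy v + z (weval a [::]) (weval a v)) =
      - (z (weval a [::]) (weval a v) - z 1%g 1%g) by zmod.
  by apply: (zsubN sU); rewrite weval_nil; exact: holonomy_1l.
rewrite weval_cons weval_cat -/(letter_value l).
set x := letter_value l; set y := weval a u; set w := weval a v.
have -> : letter_holonomy l + holonomy (u ++ v) + z x (y * w)%g -
    (letter_holonomy l + holonomy u + z x y + holonomy v + z (x * y)%g w) =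
    (holonomy (u ++ v) - (holonomy u + holonomy v + z y w)) +
    (z y w - z (x * y)%g w + z x (y * w)%g - z x y) by zmod.
exact: (zsubD sU).
Qed.

Variable rels : seq (word k).
Hypothesis pa : presents rels a.
Hypothesis rU : forall r, r \in rels -> U (holonomy r - holonomy [::]).

Lemma holonomy_equiv u v : word_equiv rels u v -> U (holonomy u - holonomy v).
Proof.
have [_ aE] := pa; elim=> {u v} [u|u v _ IH|u v w _ h _ h'|u u' v v' e h e' h'|i b|r rin].
- by rewrite subrr; exact: (zsub0 sU).
- by rewrite -opprB; exact: (zsubN sU).
- have -> : holonomy u - holonomy w =
    (holonomy u - holonomy v) + (holonomy v - holonomy w) by zmod.
  exact: (zsubD sU).
- have E := holonomy_cat u v; have E' := holonomy_cat u' v'.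
  move: E E'; have -> : weval a u = weval a u' by apply/aE.
  have -> : weval a v = weval a v' by apply/aE.
  set t := z _ _ => E E'.
  have -> : holonomy (u ++ v) - holonomy (u' ++ v') =
    (holonomy (u ++ v) - (holonomy u + holonomy v + t)) -
    (holonomy (u' ++ v') - (holonomy u' + holonomy v' + t)) +
    ((holonomy u - holonomy u') + (holonomy v - holonomy v')) by zmod.
  by apply: (zsubD sU); [apply: (zsubB sU)|apply: (zsubD sU)].
- set g := a i; have h : U (z g 1%g - z 1%g 1%g) := holonomy_1r g.
  have h' : U (z g^-1%g 1%g - z 1%g 1%g) := holonomy_1r g^-1%g.
  case: b; rewrite /= /letter_holonomy /letter_value /= weval_cons weval_nil mulg1 /= -/g.
    have := zU g g^-1%g g; rewrite mulgV mulVg => c.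
    have -> : - z 1%g 1%g - z g g^-1%g + (0 - z 1%g 1%g + z g 1%g) + z g^-1%g g -
       - z 1%g 1%g = (z g^-1%g g - z 1%g g + z g 1%g - z g g^-1%g) +
       (z 1%g g - z 1%g 1%g) by zmod.
    by apply: (zsubD sU) => //; exact: holonomy_1l.
  have -> : 0 + (- z 1%g 1%g - z g g^-1%g - z 1%g 1%g + z g^-1%g 1%g) + z g g^-1%g -
    - z 1%g 1%g = z g^-1%g 1%g - z 1%g 1%g by zmod.
  exact: h'.
- exact: rU.
Qed.

(** If the relators have trivial holonomy, the extension splits. *)
Lemma holonomy_coboundary :
  exists f : G -> A, forall x y, U (z x y - (f x + f y - f (x * y)%g)).
Proof.
have [ga aE] := pa; have [w wE] := choice ga.
exists (fun x => - holonomy (w x)) => x y.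
have E := holonomy_cat (w x) (w y).
have E' : U (holonomy (w x ++ w y) - holonomy (w (x * y)%g)).
  by apply/holonomy_equiv/aE; rewrite wE [LHS]weval_cat; congr (_ * _)%g; apply: wE.
have -> : z x y - (- holonomy (w x) - holonomy (w y) - - holonomy (w (x * y)%g)) =
  (holonomy (w x ++ w y) - holonomy (w (x * y)%g)) -
  (holonomy (w x ++ w y) - (holonomy (w x) + holonomy (w y) +
    z (weval a (w x)) (weval a (w y)))).
  have -> : weval a (w x) = x by apply: wE.
  have -> : weval a (w y) = y by apply: wE.
  by zmod.
exact: zsubB.
Qed.

End Holonomy.

(** If [H_1(G) = 0] and [H_2(G) != 0], the cohomology of [G] in degree 2 with
    coefficients in some ['F_p] does not vanish: the holonomies of the relators
    generate [H_2(G)], for the universal cocycle. *)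
Lemma H2_character (G : groupType) k r :
    has_presentation G k r -> homology_vanishes G 1 -> ~ homology_vanishes G 2 ->
  exists p, prime p /\ exists z : G -> G -> 'F_p, cocycle z /\ ~ coboundary z.
Proof.
move=> [rels [a pa]] h1 nh2; have [K [KD KE]] := boundary_section h1.
have K0 : K 0 = 0 by apply: (addrI (K 0)); rewrite -KD !addr0.
have KN x : K (- x) = - K x.
  by apply: (addrI (K x)); rewrite -KD !subrr K0.
(* A projection onto the cycles. *)
pose P c := c - K (bar_boundary c).
have PD : {morph P : c d / c + d}.
  by move=> c d; rewrite /P boundaryD KD; zmod.
have PN : {morph P : c / - c}.
  by move=> c; rewrite /P boundaryN KN; zmod.
have PZ c : bar_boundary (P c) = 0 by rewrite boundaryD boundaryN KE subrr.
(* The quotient of the chains by [S] is [H_2(G)]. *)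
pose S c := exists b : bar_chain G 3, bar_boundary b = P c.
have sS : zsubgroup S.
  split=> [|c d [b eb] [b' eb']|c [b eb]].
  - by exists 0; rewrite /P ![bar_boundary 0]fglift0 K0 subrr.
  - by exists (b + b'); rewrite boundaryD PD eb eb'.
  - by exists (- b); rewrite boundaryN PN eb.
have SB (b : bar_chain G 3) : S (bar_boundary b).
  exists b; rewrite /P (_ : bar_boundary (bar_boundary b) = 0) ?K0 ?subr0 //.
  apply: (eq_freeg_additive (f := @bar_boundary G 1 \o @bar_boundary G 2)
    (g := fun=> 0)) b => [c d|c d|t] /=; rewrite ?addr0 ?boundaryD //.
  rewrite cell3P boundary3 !(boundaryD, boundaryN) !boundary2.
  move: (tnth t 0) (tnth t 1) (tnth t _) => x y w.
  set u := cell1 (x * y * w)%g.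
  by have -> : cell1 (x * (y * w))%g = u; [rewrite /u mulgA|zmod].
have SK c : S (K (bar_boundary c)).
  by exists 0; rewrite /P KE subrr [LHS]fglift0.
pose l := [seq holonomy (@cell2 G) a s - holonomy (@cell2 G) a [::] | s <- rels].
have sl := zspan_subgroup l sS; pose U := zspan S l.
have full c : U c.
  rewrite -[c](subrK (K (bar_boundary c))).
  apply: (zsubD sl); last exact: zspan_sub.
  have [x y w|s sin|f fE] := holonomy_coboundary (z := @cell2 G) sl _ pa.
  - by apply: zspan_sub => //; rewrite -boundary3; exact: SB.
  - by apply: zspan_gen => //; apply: (map_f (fun s => _)).
  (* The universal cocycle is a coboundary modulo [U], so [U] contains all cycles. *)
  pose g := flift (fun t : 1.-tuple G => f (tnth t 0)).
  have h d : U (d - g (bar_boundary d)).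
    move: d; apply: freeg_subgroup => [|t].
      split=> [|d e hd he|d hd].
      - by rewrite ![bar_boundary 0]fglift0 [g 0]flift0 subrr; exact: (zsub0 sl).
      - rewrite boundaryD [g _]fliftD.
        have -> : d + e - (g (bar_boundary d) + g (bar_boundary e)) =
          (d - g (bar_boundary d)) + (e - g (bar_boundary e)) by zmod.
        exact: (zsubD sl).
      - by rewrite boundaryN [g _]fliftN -opprD; exact: (zsubN sl).
    rewrite cell2P; move: (tnth t 0) (tnth t 1) => x y; have := fE x y.
    rewrite boundary2 [g _]fliftD fliftB !fliftU !(tnth_nth 1%g) /=.
    have -> // : cell2 x y - (f x + f y - f (x * y)%g) =
      cell2 x y - (f y - f (x * y)%g + f x) by zmod.
  have := h (P c); rewrite PZ [g 0]flift0 subr0.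
  exact.
have [c0 [c0Z c0B]] : exists c : bar_chain G 2, bar_boundary c = 0 /\
    ~ exists b : bar_chain G 3, bar_boundary b = c.
  apply: contrapT => h; apply: nh2 => c cZ; apply: contrapT => h'; apply: h.
  by exists c.
have hex : exists c, ~ S c by exists c0; rewrite /S /P c0Z K0 subr0.
have [p [pp [f [fD f0 [c fc]]]]] := zspan_character sS full hex.
have fN x : f (- x) = - f x.
  by apply/eqP; rewrite -addr_eq0 -fD addNr f0 //; exact: (zsub0 sS).
exists p; split=> //; exists (fun x y => f (cell2 x y)); split=> [x y w|[g gE]].
  by rewrite -!fN -!fD -boundary3 f0.
apply: fc; rewrite -[c](subrK (K (bar_boundary c))) fD [X in _ + X]f0 // addr0.
pose g' := flift (fun t : 1.-tuple G => g (tnth t 0)).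
have fg d : f d = g' (bar_boundary d).
  move: d; apply: (eq_freeg_additive (g := g' \o @bar_boundary G 1)) => // [x y|t] /=.
    by rewrite boundaryD [g' _]fliftD.
  rewrite cell2P; move: (tnth t 0) (tnth t 1) => x y.
  by rewrite gE boundary2 [g' _]fliftD fliftB !fliftU !(tnth_nth 1%g) /=; zmod.
by rewrite -/(P c) fg PZ [LHS]flift0.
Qed.

(** * Lower bounds for the number of relators *)

(** A matrix over a field with fewer columns than rows has a non-trivial relation
    between its rows. *)
Lemma row_relation (F : fieldType) (L : finType) n (M : L -> 'I_n -> F) :
    (n < #|L|)%N ->
  exists2 c : L -> F, (exists i, c i != 0) & forall j, \sum_i c i * M i j = 0.
Proof.
move=> nm; pose A := \matrix_(i < #|L|, j < n) M (enum_val i) j.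
have : kermx A != 0.
  by rewrite -mxrank_eq0 mxrank_ker -lt0n subn_gt0 (leq_ltn_trans (rank_leq_col A)).
case/rowV0Pn => v /sub_kermxP vA v0.
have [i vi] : exists i, v 0 i != 0.
  apply/existsP; apply: contraNT v0; rewrite negb_exists => /forallP h.
  by apply/eqP/rowP => i; rewrite mxE; apply/eqP; move: (h i); rewrite negbK.
exists (fun l => v 0 (enum_rank l)); first by exists (enum_val i); rewrite enum_valK.
move=> j; move/rowP/(_ j): vA; rewrite !mxE => e; rewrite -[RHS]e.
rewrite (reindex (enum_val : 'I_#|L| -> L)) /=; last first.
  by exists enum_rank => l _; rewrite ?enum_valK ?enum_rankK.
by apply: eq_bigr => l _; rewrite mxE enum_valK.
Qed.

(** The number of relators is at least the dimension of the second cohomology. *)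
Lemma relators_cohomology (G : groupType) (F : fieldType) (L : finType) k r
    (z : L -> G -> G -> F) :
    has_presentation G k r -> (forall i, cocycle (z i)) ->
    (forall c : L -> F, coboundary (fun x y => \sum_i c i * z i x y) ->
       forall i, c i = 0) ->
  (#|L| <= r)%N.
Proof.
move=> [rels [a pa]] zc zi; rewrite leqNgt; apply/negP => rm.
pose M i (j : 'I_r) := holonomy (z i) a (tnth rels j) - holonomy (z i) a [::].
have [c [i /eqP ci] cM] := row_relation M rm; apply: ci; apply: zi.
set zz := fun x y => \sum_i c i * z i x y.
have hE w : holonomy zz a w = \sum_i c i * holonomy (z i) a w.
  elim: w => [|[l b] w IH] /=.
    by rewrite -sumrN; apply: eq_bigr => j _; rewrite mulrN.
  under [RHS]eq_bigr do rewrite !mulrDr; rewrite !big_split /= -IH.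
  congr (_ + _ + _); case: b; rewrite /letter_holonomy /=.
    by rewrite -!sumrN -big_split; apply: eq_bigr => j _; rewrite mulrBr mulrN.
  by rewrite big1 // => j _; rewrite mulr0.
have [f fE] : exists f : G -> F, forall x y, (fun u => u = 0) (zz x y - (f x + f y - f (x * y)%g)).
  apply: (holonomy_coboundary (U := fun u => u = 0) _ _ pa).
  - by split=> [//|x y -> ->|x ->]; rewrite ?addr0 ?oppr0.
  - move=> x y w; rewrite -!sumrN -!big_split big1 // => j _.
    by rewrite /= -!mulrN -!mulrDr zc mulr0.
  - move=> s /tnthP[j ->]; rewrite !hE -sumrN -big_split -[RHS](cM j).
    by apply: eq_bigr => l _; rewrite /= -mulrBr.
by exists f => x y; apply/eqP; rewrite -subr_eq0 fE.
Qed.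

Section PowerLowerBounds.

Variables (T : finType) (G : groupType).
Implicit Types (t : T) (g h : G).

Notation inj t g := (pinj (pred1 (t : T)) g).

Lemma pinj1 t g : inj t g t = g.
Proof. by rewrite ffunE /= eqxx. Qed.

Lemma pinj1_neq s t g : s != t -> inj t g s = 1%g.
Proof. by rewrite ffunE /= => /negPf ->. Qed.

(** A non-trivial homomorphism from [G] to a field [F] induces a homomorphism from
    [G^T] to [F^T] whose image spans [F^T]. *)
Lemma generators_character (F : fieldType) (f : G -> F) k
    (a : 'I_k -> {ffun T -> G}) :
    {morph f : x y / (x * y)%g >-> x + y} -> (exists g, f g <> 0) ->
    generates a ->
  (#|T| <= k)%N.
Proof.
move=> fM [g fg] ga; rewrite leqNgt; apply/negP => kT.
have f1 : f 1%g = 0 by apply: (addrI (f 1%g)); rewrite -fM mulg1 addr0.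
have fV x : f x^-1%g = - f x.
  by apply: (addrI (f x)); rewrite -fM mulgV subrr.
have [c [t ct] cM] := row_relation (fun t j => f (a j t)) kT.
pose F' (x : {ffun T -> G}) := \sum_s c s * f (x s).
have F0 x : F' x = 0.
  have [w <-] := ga x; rewrite /F'.
  apply: (subgroup_weval (H := fun x => F' x = 0) w) => //.
  split=> [|y z hy hz|y hy]; rewrite /F'.
  - by rewrite big1 // => s _; rewrite one_ffunE f1 mulr0.
  - transitivity (F' y + F' z); last by rewrite hy hz addr0.
    by rewrite -big_split; apply: eq_bigr => s _; rewrite mul_ffunE fM mulrDr.
  - transitivity (- F' y); last by rewrite hy oppr0.
    by rewrite -sumrN; apply: eq_bigr => s _; rewrite inv_ffunE fV mulrN.
have := F0 (inj t g); rewrite /F' (bigD1 t) //= pinj1 big1 ?addr0; last first.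
  by move=> s st; rewrite pinj1_neq // f1 mulr0.
by move/eqP; rewrite mulf_eq0 (negPf ct) => /eqP.
Qed.

(** The products of the characters of two distinct factors define independent
    classes, as coboundaries are symmetric on commuting pairs. *)
Lemma relators_character (F : fieldType) (f : G -> F) (A B : finType)
    (lo : A -> T) (hi : B -> T) k r :
    {morph f : x y / (x * y)%g >-> x + y} -> (exists g, f g <> 0) ->
    injective lo -> injective hi -> (forall i j, lo i != hi j) ->
    has_presentation {ffun T -> G} k r ->
  (#|A| * #|B| <= r)%N.
Proof.
move=> fM [g /eqP fg] loI hiI lohi hp; rewrite -card_prod.
have f1 : f 1%g = 0 by apply: (addrI (f 1%g)); rewrite -fM mulg1 addr0.
pose z (p : A * B) (x y : {ffun T -> G}) := f (x (lo p.1)) * f (y (hi p.2)).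
apply: (relators_cohomology (z := z)) hp _ _ => [p x y w|c [e eE] [i j]].
  by rewrite /z !mul_ffunE !fM; ring.
pose x := inj (lo i) g; pose y := inj (hi j) g.
have xy : (x * y = y * x)%g.
  by apply: pinj_commute => t /eqP -> /eqP e'; have := lohi i j; rewrite e' eqxx.
have : \sum_p c p * z p x y = \sum_p c p * z p y x.
  by rewrite [LHS]eE [RHS]eE xy (addrC (e x)).
rewrite (bigD1 (i, j)) //= [X in _ + X]big1 ?addr0; last first.
  move=> [i' j'] /= ne; rewrite /z /=.
  have [ii|ii] := eqVneq i' i; last by rewrite pinj1_neq ?f1 ?mul0r ?mulr0 // inj_eq.
  rewrite (@pinj1_neq (hi j')) ?f1 ?mulr0 // inj_eq //.
  by apply: contra_neq ne => ->; rewrite ii.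
rewrite big1; last first.
  by move=> [i' j'] _; rewrite /z /= pinj1_neq // f1 mul0r mulr0.
rewrite /z /= !pinj1 => /eqP; rewrite !mulf_eq0 (negPf fg) !orbF.
by move/eqP.
Qed.

(** The pull-backs of a class in degree 2 by the projections are independent. *)
Lemma relators_cocycle (F : fieldType) (z : G -> G -> F) k r :
    cocycle z -> ~ coboundary z -> has_presentation {ffun T -> G} k r ->
  (#|T| <= r)%N.
Proof.
move=> zc nz hp; pose zz t (x y : {ffun T -> G}) := z (x t) (y t).
apply: (relators_cohomology (z := zz)) hp _ _ => [t x y w|c [e eE] t].
  by rewrite /zz !mul_ffunE zc.
apply/eqP; apply: contra_notT nz => ct.
pose K := \sum_(s | s != t) c s * z 1%g 1%g.
exists (fun g => (c t)^-1 * (e (inj t g) - K)) => x y.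
have := eE (inj t x) (inj t y); rewrite -pinjM (bigD1 t) //= /zz !pinj1.
have -> : \sum_(s | s != t) c s * z (inj t x s) (inj t y s) = K.
  by apply: eq_bigr => s st; rewrite !pinj1_neq.
move=> E; apply: (mulfI ct).
by rewrite -mulrDr -mulrBr mulrA divff // mul1r -[LHS](addrK K) E; ring.
Qed.

(** Distinct factors give distinct maps from the generators to a quotient. *)
Lemma generators_quotient (Q : finGroupType) (f : {multiplicative G -> Q}) k
    (a : 'I_k -> {ffun T -> G}) :
    is_quotient f -> (1 < #|Q|)%N -> generates a ->
  (#|T| <= #|Q| ^ k)%N.
Proof.
move=> fS Q1 ga; rewrite -[k]card_ord -card_ffun.
apply: (@leq_card _ _ (fun t => [ffun j => f (a j t)])) => s t /ffunP st.
have fM : {morph f : x y / (x * y)%g >-> (x * y)%g} by exact: gmulfM.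
apply/eqP; apply: contraLR Q1 => nst; rewrite -leqNgt.
have fst (x : {ffun T -> G}) : f (x s) = f (x t).
  have [w <-] := ga x; rewrite -[word_eval a w]/(weval a w).
  rewrite !weval_ffunE !(hom_weval fM).
  by apply: eq_weval => j; have := st j; rewrite !ffunE.
have f1 (q : Q) : q = 1%g.
  have [g <-] := fS q; have := fst (inj s g).
  by rewrite pinj1 pinj1_neq 1?eq_sym // => ->; exact: hom1 fM.
by apply/fintype_le1P => q q'; rewrite (f1 q) (f1 q').
Qed.

End PowerLowerBounds.

(** A presentation of a perfect group has at least as many relators as generators,
    as the relators span the free abelian group on the generators, rationally. *)
Lemma perfect_relators (P : groupType) k r :
  perfect P -> has_presentation P k r -> (k <= r)%N.
Proof.
move=> pP [rels [a [ga aE]]]; rewrite leqNgt; apply/negP => rk.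
rewrite -[k]card_ord in rk.
have [c [i /eqP ci] cM] := row_relation
  (fun i (j : 'I_r) => asum (fun l : 'I_k => (l == i)%:R : rat) (tnth rels j)) rk.
have cE w : asum c w = \sum_i c i * asum (fun l : 'I_k => (l == i)%:R : rat) w.
  elim: w => [|[l b] w IH].
    by rewrite asum_nil big1 // => l _; rewrite asum_nil mulr0.
  under eq_bigr do rewrite asum_cons mulrDr; rewrite big_split -IH asum_cons /=.
  congr (_ + _); rewrite (bigD1 l) //= big1 ?addr0 => [|s /negPf sl].
    by rewrite eqxx; case: b; rewrite ?mulrN mulr1.
  by rewrite eq_sym sl; case: b; rewrite ?oppr0 mulr0.
have eqv u v : word_equiv rels u v -> asum c u = asum c v.
  elim=> [|? ? _ -> |? ? ? _ -> _ ->|u1 u2 v1 v2 _ h _ h'|l b|s /tnthP[j ->]] //.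
  - by rewrite !asum_cat h h'.
  - by rewrite !asum_cons asum_nil; case: b => /=; rewrite addr0 ?addNr ?subrr.
  - by rewrite asum_nil cE cM.
have [w wE] := choice ga; apply: ci.
have := pP _ (fun x => asum c (w x)) _ (a i).
have -> : asum c (w (a i)) = c i.
  rewrite -(asum_letter c i); apply: eqv; apply/aE; rewrite wE.
  exact: esym (weval_letter a i).
apply=> x y; rewrite -asum_cat; apply: eqv; apply/aE.
by rewrite wE [RHS]weval_cat; congr (_ * _)%g; apply: esym; exact: wE.
Qed.

(** The standard presentation of a direct power: the relators of each factor, and
    the commutators of generators of distinct factors. *)
Lemma power_presentation (G : groupType) k r n :
    has_presentation G k r ->
  has_presentation (power G n) (n * k) (n * r + (n * k) ^ 2).
Proof.
move=> /has_presentationE[relsG sr [x hx]]; have [gx sx _] := hx.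
pose I : finType := ('I_n * 'I_k)%type.
pose a (p : I) : {ffun 'I_n -> G} := pinj (pred1 p.1) (x p.2).
pose fac i : 'I_k -> seq (I * bool) := fun s => letter (i, s).
pose rels : seq (seq (I * bool)) :=
  [seq wsubst (fac i) s | i <- enum 'I_n, s <- relsG] ++
  [seq if p.1 == q.1 then [::] else wcomm (letter p) (letter q)
     | p <- enum I, q <- enum I].
have facE (E : groupType) (b : I -> E) i w :
    weval b (wsubst (fac i) w) = weval (fun s => b (i, s)) w.
  by rewrite weval_subst; apply: eq_weval => s; rewrite weval_letter.
have facA i w : weval (fun s => a (i, s)) w = pinj (pred1 i) (weval x w).
  by rewrite (hom_weval (pinjM _)).
have ha : wpresents rels a.
  split.
  - apply: ffun_induct => [|i g]; first exact: span_subgroup.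
    by have [w <-] := gx g; exists (wsubst (fac i) w); rewrite facE facA.
  - move=> s; rewrite mem_cat => /orP[/allpairsP[[i q] [_ qin ->]]|
      /allpairsP[[p q] [_ _ ->]]] /=.
      by rewrite facE facA sx // (hom1 (pinjM _)).
    case: eqVneq => pq; first exact: weval_nil.
    apply/weval_wcomm; rewrite !weval_letter; apply: pinj_commute => t /eqP -> /eqP e.
    by rewrite e eqxx in pq.
  - move=> u u1 E b sb.
    have hf i : exists f : G -> E, {morph f : x y / (x * y)%g} /\
        forall s, f (x s) = b (i, s).
      have [s sin|f fM fE] := wpresents_hom hx (b := fun s => b (i, s)).
        rewrite -facE; apply: sb; rewrite mem_cat; apply/orP; left.
        by apply/allpairsP; exists (i, s); rewrite mem_enum.
      by exists f.
    have [f fP] := choice hf.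
    have cb p q : p.1 != q.1 -> commute (b p) (b q).
      move=> pq; have /weval_wcomm : weval b (wcomm (letter p) (letter q)) = 1%g.
        apply: sb; rewrite mem_cat; apply/orP; right.
        by apply/allpairsP; exists (p, q); rewrite !mem_enum /= (negPf pq).
      by rewrite !weval_letter.
    have cf i j g h : i != j -> commute (f i g) (f j h).
      move=> ij; have [w <-] := gx g; have [v <-] := gx h.
      have [fiM fiE] := fP i; have [fjM fjE] := fP j.
      rewrite (hom_weval fiM) (hom_weval fjM).
      apply: subgroup_weval (commute_subgroup _) _ => t; apply: commute_sym.
      apply: subgroup_weval (commute_subgroup _) _ => s.
      by rewrite fiE fjE; apply/commute_sym/cb.
    have FM := power_homM (f := f) (fun t => (fP t).1) cf.
    have Fa p : power_hom f (a p) = b p.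
      case: p => i s; have [_ fE] := fP i.
      by rewrite power_hom_factor ?fE // => j; case: (fP j).
    rewrite -[RHS](hom1 FM) -u1 (hom_weval FM).
    by apply: eq_weval => p; rewrite Fa.
have := has_presentation_finType ha (r := (n * r + (n * k) ^ 2)%N).
rewrite card_prod !card_ord; apply.
by rewrite size_cat !size_allpairs -!cardE card_prod !card_ord sr mulnn.
Qed.

Local Open Scope classical_set_scope.
Local Open Scope ring_scope.

(** * Asymptotic estimates *)

(** The properties of the least element of a non-empty set of numbers. *)
Lemma leastP (P : nat -> Prop) m : P m -> P (least P) /\ (least P <= m)%N.
Proof.
move=> Pm; have hex : exists n, `[< P n >] by exists m; apply/asboolP.
have [n /asboolP Pn minn] := ex_minnP hex.
have h : [set n | P n /\ forall m, P m -> (n <= m)%N] n.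
  by split=> // i Pi; apply: minn; apply/asboolP.
have [] := xgetPex 0%N (ex_intro _ n h).
by rewrite -/(least P) => hP hmin; split=> //; exact: hmin.
Qed.

Lemma min_generators_spec (P : groupType) k r : has_presentation P k r ->
  (exists a : 'I_(min_generators P) -> P, generates a) /\ (min_generators P <= k)%N.
Proof.
move=> [rels [a [ga _]]].
exact: (leastP (P := fun k => exists a : 'I_k -> P, generates a) (ex_intro _ a ga)).
Qed.

Lemma min_relators_spec (P : groupType) k r : has_presentation P k r ->
  (exists k, has_presentation P k (min_relators P)) /\ (min_relators P <= r)%N.
Proof.
move=> hp.
exact: (leastP (P := fun r => exists k, has_presentation P k r) (ex_intro _ k hp)).
Qed.

Section Asymptotics.

Variable R : realType.
Implicit Types (f h : nat -> nat) (g : nat -> R).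

Lemma asympO_le f h g : (forall n, (f n <= h n)%N) -> asympO h g -> asympO f g.
Proof.
move=> fh [c c0 hc]; exists c => //; near=> n.
apply: (@le_trans _ _ (h n)%:R); first by rewrite ler_nat.
by near: n.
Unshelve. all: by end_near. Qed.

Lemma asympO_nat f e C : (forall n, (0 < n)%N -> (f n <= C * n ^ e)%N) ->
  asympO f (fun n => n%:R ^+ e : R).
Proof.
move=> hf; exists C.+1%:R; first by rewrite ltr0n.
exists 1%N => // n /= n0; rewrite -natrX -natrM ler_nat.
by apply: leq_trans (hf n n0) _; rewrite leq_mul2r leqnSn orbT.
Qed.

Lemma up_log_ln n : (1 < n)%N -> (up_log 2 n).+1%:R <= 3%:R / ln 2%:R * ln n%:R :> R.
Proof.
move=> n1; have l2 : 0 < ln 2%:R :> R by rewrite ln_gt0 // ltr1n.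
have le2n : ln 2%:R <= ln n%:R :> R by rewrite ler_ln ?posrE ?ltr0n ?ler_nat // ltnW.
have m0 : (0 < up_log 2 n)%N by rewrite up_log_gt0.
have lt : ((up_log 2 n).-1)%:R * ln 2%:R <= ln n%:R :> R.
  rewrite mulr_natl -lnXn ?ltr0n // -natrX ler_ln ?posrE ?ltr0n ?expn_gt0 //.
    by rewrite ler_nat ltnW // up_log_gtn.
  exact: ltnW.
rewrite mulrAC ler_pdivlMr //; case: (up_log 2 n) m0 lt => // m _ /= lt.
by rewrite -[m.+2]addn2 natrD mulrDl; lra.
Qed.

Lemma asympO_up_log f e C : (forall n, (f n <= C * (up_log 2 n).+1 ^ e)%N) ->
  asympO f (fun n => ln n%:R ^+ e : R).
Proof.
move=> hf; have l2 : 0 < ln 2%:R :> R by rewrite ln_gt0 // ltr1n.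
have c0 : 0 < 3%:R / ln 2%:R :> R by rewrite divr_gt0 // ltr0n.
exists (C.+1%:R * (3%:R / ln 2%:R) ^+ e); first by rewrite mulr_gt0 ?ltr0n ?exprn_gt0.
exists 2%N => // n /= n2; apply: (@le_trans _ _ (C * (up_log 2 n).+1 ^ e)%:R).
  by rewrite ler_nat.
rewrite natrM natrX -mulrA -exprMn; apply: ler_pM => //; first by rewrite ler_nat.
by apply: lerXn2r; rewrite ?nnegrE ?up_log_ln // mulr_ge0 ?ltW // ln_gt0 // ltr1n.
Qed.

Lemma asympOmega_nat f e C : (0 < C)%N ->
    (forall n, (1 < n)%N -> (n ^ e <= C * f n)%N) ->
  asympOmega f (fun n => n%:R ^+ e : R).
Proof.
move=> C0 hf; exists C%:R^-1; first by rewrite invr_gt0 ltr0n.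
exists 2%N => // n /= n2; rewrite ler_pdivrMl ?ltr0n // -natrX -natrM ler_nat.
exact: hf.
Qed.

Lemma asympOmega_log f q : (1 < q)%N -> (forall n, (n <= q ^ f n)%N) ->
  asympOmega f (fun n => ln n%:R : R).
Proof.
move=> q1 hf; have lq : 0 < ln q%:R :> R by rewrite ln_gt0 // ltr1n.
exists (ln q%:R)^-1; first by rewrite invr_gt0.
exists 1%N => // n /= n0; rewrite ler_pdivrMl // mulrC mulr_natl -lnXn ?ltr0n //.
  by rewrite -natrX ler_ln ?posrE ?ltr0n ?expn_gt0 ?(ltnW q1) // ler_nat.
exact: ltnW.
Qed.

End Asymptotics.

Lemma cube_leq_exp m : (m.+1 ^ 3 <= 8 * 2 ^ m)%N.
Proof.
have [|m3] := ltnP m 3; first by case: m => [|[|[|]]].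
elim: m m3 => // m IH; rewrite leq_eqVlt => /orP[/eqP <- //|m3].
have {}IH := IH m3; rewrite (expnS 2); have : (m.+2 ^ 3 <= 2 * m.+1 ^ 3)%N.
  by rewrite !expnS expn0; nia.
by lia.
Qed.

Lemma up_log_exp_leq n : (0 < n)%N -> (2 ^ up_log 2 n <= 2 * n)%N.
Proof.
move=> n0; have [n1|] := ltnP 1 n; last by case: n n0 => [|[|]].
have : (0 < up_log 2 n)%N by rewrite up_log_gt0.
have := up_log_gtn (isT : (1 < 2)%N) n1.
by case: (up_log 2 n) => // m lt _; rewrite expnS leq_mul2l ltnW.
Qed.

Lemma leq_sqr_half n : (1 < n)%N -> (n ^ 2 <= 16 * (n./2 * n./2))%N.
Proof.
move=> n1; have := odd_double_half n; rewrite -mul2n => e.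
have : (odd n <= 1)%N by case: odd.
have : (0 < n./2)%N by rewrite half_gt0.
by rewrite expnS expn1; nia.
Qed.

(** * The growth of the number of generators and relators *)

Section Growth.

Variables (R : realType) (G : groupType) (k0 r0 : nat).
Hypothesis hG : has_presentation G k0 r0.

Let d n := min_generators (power G n).
Let rho n := min_relators (power G n).

Lemma power_specs n : (exists a : 'I_(d n) -> power G n, generates a) /\
  (exists k, has_presentation (power G n) k (rho n)).
Proof.
have hp := power_presentation n hG.
by split; [case: (min_generators_spec hp)|case: (min_relators_spec hp)].
Qed.

Lemma power_presentations_bounds (K L : nat -> R) :
    power_presentations G (fun k => asympO k K) (fun r => asympO r L) ->
  asympO d K /\ asympO rho L.
Proof.
move=> [k [r [hp hk hr]]]; split.
  by apply: asympO_le hk => n; case: (min_generators_spec (hp n)).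
by apply: asympO_le hr => n; case: (min_relators_spec (hp n)).
Qed.

Lemma cube_family_bound m i :
  (i <= m)%N -> (#|cube_index 'I_k0 i| <= 2 * k0 * m.+1)%N.
Proof. by move=> im; rewrite card_cube_index card_ord; nia. Qed.

Lemma upper_H1 : power_presentations G
  (fun k => asympO k (fun n => n%:R : R)) (fun r => asympO r (fun n => n%:R ^+ 2 : R)).
Proof.
exists (fun n => n * k0)%N, (fun n => n * r0 + (n * k0) ^ 2)%N; split.
- by move=> n; exact: power_presentation.
- have -> : (fun n => n%:R : R) = (fun n => n%:R ^+ 1) by apply/funext => n.
  by apply: (asympO_nat R (C := k0)) => n _; rewrite expn1 mulnC.
- apply: (asympO_nat R (C := (r0 + k0 ^ 2)%N)) => n n0.
  by rewrite expnMn mulnDl mulnC (mulnC (n ^ 2)%N) leq_add2r leq_mul2l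
    expnS expn1 leq_pmulr ?orbT.
Qed.

Lemma upper_perfect : perfect G -> power_presentations G
  (fun k => asympO k (fun n => ln n%:R : R)) (fun r => asympO r (fun n => n%:R : R)).
Proof.
move=> pG; have /has_presentationE[rels sr [x hx]] := hG; have [gx _ _] := hx.
pose K n := (2 * k0 * (up_log 2 n).+1)%N.
exists (fun n => #|cube_index 'I_k0 (up_log 2 n)|).
exists (fun n => r0 + (up_log 2 n).+1 * (K n ^ 2 + 3 * K n) + 2 ^ up_log 2 n * r0 + k0)%N.
split.
- move=> n; apply: (perfect_power_presentation pG hx (a := cube_gens x) _ _
    (cube_family_bound (m := up_log 2 n))).
  + by move=> m; exact: cube_gens_generate.
  + exact: up_logP.
  + by rewrite sr card_ord.
- have -> : (fun n => ln n%:R : R) = (fun n => ln n%:R ^+ 1) by apply/funext => n.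
  apply: (asympO_up_log R (C := (2 * k0)%N)) => n; rewrite expn1.
  exact: cube_family_bound.
- have -> : (fun n => n%:R : R) = (fun n => n%:R ^+ 1) by apply/funext => n.
  apply: (asympO_nat R (C := (r0 + 16 * (4 * k0 ^ 2 + 6 * k0) + 2 * r0 + k0)%N)) => n n0.
  rewrite expn1; have := up_log_exp_leq n0; have := cube_leq_exp (up_log 2 n).
  rewrite /K; move: (up_log 2 n) => m; move: (2 ^ m)%N => p h1 h2.
  have h3 : (m.+1 * ((2 * k0 * m.+1) ^ 2 + 3 * (2 * k0 * m.+1)) <=
             (4 * k0 ^ 2 + 6 * k0) * m.+1 ^ 3)%N by rewrite !expnS !expn0; nia.
  have h4 : (m.+1 ^ 3 <= 16 * n)%N by lia.
  nia.
Qed.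

Lemma upper_lifting : perfect G -> lifting G -> power_presentations G
  (fun k => asympO k (fun n => ln n%:R : R)) (fun r => asympO r (fun n => ln n%:R ^+ 3 : R)).
Proof.
move=> pG lG; have /has_presentationE[rels sr [x hx]] := hG; have [gx _ _] := hx.
pose K n := (2 * k0 * (up_log 2 n).+1)%N.
exists (fun n => #|cube_index 'I_k0 (up_log 2 n)|).
exists (fun n => r0 + (up_log 2 n).+1 * (K n ^ 2 + 3 * K n) + k0)%N.
split.
- move=> n; apply: (lifting_power_presentation pG hx (a := cube_gens x) _ lG _
    (cube_family_bound (m := up_log 2 n))).
  + by move=> m; exact: cube_gens_generate.
  + exact: up_logP.
  + by rewrite sr card_ord.
- have -> : (fun n => ln n%:R : R) = (fun n => ln n%:R ^+ 1) by apply/funext => n.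
  apply: (asympO_up_log R (C := (2 * k0)%N)) => n; rewrite expn1.
  exact: cube_family_bound.
- apply: (asympO_up_log R (C := (r0 + (4 * k0 ^ 2 + 6 * k0) + k0)%N)) => n.
  rewrite /K; move: (up_log 2 n) => m.
  have h3 : (m.+1 * ((2 * k0 * m.+1) ^ 2 + 3 * (2 * k0 * m.+1)) <=
             (4 * k0 ^ 2 + 6 * k0) * m.+1 ^ 3)%N by rewrite !expnS !expn0; nia.
  have : (0 < m.+1 ^ 3)%N by rewrite expn_gt0.
  nia.
Qed.

Lemma upper_infinite_order (g : G) :
    perfect G -> lifting G -> infinite_order_in_quotients g ->
  power_presentations G (fun k => forall n, (k n <= min_generators G + 1)%N)
    (fun r => asympO r (fun n => ln n%:R : R)).
Proof.
move=> pG lG gP; have /has_presentationE[rels sr [x hx]] := hG.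
have [[y gy] _] := min_generators_spec hG.
pose I (m : nat) : finType := option 'I_(min_generators G).
have cI m : #|I m| = (min_generators G).+1 by rewrite card_option card_ord.
pose K := (min_generators G).+1.
exists (fun n => #|I n|), (fun n => r0 + (up_log 2 n).+1 * (K ^ 2 + 3 * K) + k0)%N.
split.
- move=> n; apply: (lifting_power_presentation (I := I) (K := K) pG hx
    (a := fun m => infinite_order_gen (cube m) y g) _ lG (up_logP _ _)) => //.
  + by move=> m; exact: infinite_order_generates.
  + by move=> i _; rewrite cI.
  + by rewrite sr card_ord.
- by move=> n; rewrite cI addn1.
- have -> : (fun n => ln n%:R : R) = (fun n => ln n%:R ^+ 1) by apply/funext => n.
  apply: (asympO_up_log R (C := (r0 + (K ^ 2 + 3 * K) + k0)%N)) => n.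
  by rewrite expn1; nia.
Qed.

Lemma lower_H1 : ~ homology_vanishes G 1 ->
  asympOmega d (fun n => n%:R : R) /\ asympOmega rho (fun n => n%:R ^+ 2 : R).
Proof.
move=> nh1; have [rels [a [ga _]]] := hG.
have [p [_ [f [fM fn]]]] := H1_character ga nh1; split.
  have -> : (fun n => n%:R : R) = (fun n => n%:R ^+ 1) by apply/funext => n.
  apply: (asympOmega_nat R (C := 1)) => // n _; rewrite expn1 mul1n.
  have [[b gb] _] := power_specs n.
  by have := generators_character fM fn gb; rewrite card_ord.
apply: (asympOmega_nat R (C := 16)) => // n n1; apply: leq_trans (leq_sqr_half n1) _.
rewrite leq_mul2l /=; have [_ [k hp]] := power_specs n.
have half : (n./2 + n./2 <= n)%N by rewrite addnn -{2}(odd_double_half n) leq_addl.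
have lt (i : 'I_(n./2)) : (i < n)%N by have := ltn_ord i; lia.
have lt' (i : 'I_(n./2)) : (n./2 + i < n)%N by have := ltn_ord i; lia.
have := relators_character (lo := fun i => Ordinal (lt i))
  (hi := fun i => Ordinal (lt' i)) fM fn _ _ _ hp.
rewrite !card_ord; apply.
- by move=> i j /(congr1 val) /= e; apply/val_inj.
- by move=> i j /(congr1 val) /= /addnI e; apply/val_inj.
- move=> i j; apply/eqP => /(congr1 val) /= e.
  by have := ltn_ord i; rewrite e ltnNge leq_addr.
Qed.

Lemma lower_H2 : homology_vanishes G 1 -> ~ homology_vanishes G 2 ->
  asympOmega rho (fun n => n%:R : R).
Proof.
move=> h1 nh2; have [p [_ [z [zc nz]]]] := H2_character hG h1 nh2.
have -> : (fun n => n%:R : R) = (fun n => n%:R ^+ 1) by apply/funext => n.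
apply: (asympOmega_nat R (C := 1)) => // n _; rewrite expn1 mul1n.
have [_ [k hp]] := power_specs n.
by have := relators_cocycle zc nz hp; rewrite card_ord.
Qed.

Lemma lower_finite_quotient : perfect G -> has_nontrivial_finite_quotient G ->
  asympOmega d (fun n => ln n%:R : R) /\ asympOmega rho (fun n => ln n%:R : R).
Proof.
move=> pG [Q [f [fS Q1]]]; have hd n : (n <= #|Q| ^ d n)%N.
  have [[a ga] _] := power_specs n.
  by have := generators_quotient fS Q1 ga; rewrite card_ord.
split; apply: (asympOmega_log R Q1) => // n; apply: leq_trans (hd n) _.
rewrite leq_pexp2l ?(ltnW Q1) //; have [_ [k hp]] := power_specs n.
apply: leq_trans (perfect_relators (@perfect_power _ _ pG) hp).
by case: (min_generators_spec hp).
Qed.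

End Growth.

Theorem theorem1p1 (R : realType) (G : groupType) (hG : finitely_presented G) :
  let d n := min_generators (power G n) in
  let rho n := min_relators (power G n) in
  let log n : R := ln n%:R in
  [/\ (* (1) *)
      ~ homology_vanishes G 1 ->
      [/\ asympTheta d (fun n => n%:R : R),
          asympTheta rho (fun n => n%:R ^+ 2 : R)
        & power_presentations G
            (fun k => asympO k (fun n => n%:R : R))
            (fun r => asympO r (fun n => n%:R ^+ 2 : R))],
      (* (2) *)
      homology_vanishes G 1 -> ~ homology_vanishes G 2 ->
      [/\ asympO d log,
          asympTheta rho (fun n => n%:R : R)
        & power_presentations G
            (fun k => asympO k log)
            (fun r => asympO r (fun n => n%:R : R))],
      (* (3) *)
      homology_vanishes G 1 -> homology_vanishes G 2 ->
      [/\ asympO d log,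
          asympO rho (fun n => log n ^+ 3)
        & power_presentations G
            (fun k => asympO k log)
            (fun r => asympO r (fun n => log n ^+ 3))],
      (* (4) *)
      homology_vanishes G 1 -> homology_vanishes G 2 ->
      has_nontrivial_finite_quotient G ->
      [/\ asympTheta d log,
          (exists c0 c1 : R, [/\ 0 < c0, 0 < c1
             & \forall n \near \oo,
                 c0 * log n <= (rho n)%:R <= c1 * log n ^+ 3])
        & power_presentations G
            (fun k => asympO k log)
            (fun r => asympO r (fun n => log n ^+ 3))]
    & (* (5) *)
      homology_vanishes G 1 -> homology_vanishes G 2 ->
      (exists g : G, infinite_order_in_quotients g) ->
      [/\ forall n, (d n <= min_generators G + 1)%N,
          asympO rho log
        & power_presentations G
            (fun k => forall n, (k n <= min_generators G + 1)%N)
            (fun r => asympO r log)]].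
Proof.
move=> d rho log; have [k0 [r0 hp]] := hG; split.
- move=> nh1; have up := upper_H1 R hp; have [hd hr] := power_presentations_bounds up.
  by have [ld lr] := lower_H1 R hp nh1.
- move=> h1 nh2; have up := upper_perfect R hp (H1_perfect h1).
  have [hd hr] := power_presentations_bounds up.
  by split=> //; split=> //; exact: lower_H2 hp h1 nh2.
- move=> h1 h2; have up := upper_lifting R hp (H1_perfect h1) (H2_lifting h1 h2).
  by have [] := power_presentations_bounds up.
- move=> h1 h2 hQ; have up := upper_lifting R hp (H1_perfect h1) (H2_lifting h1 h2).
  have [hd [c1 c10 hr]] := power_presentations_bounds up.
  have [ld [c0 c00 lr]] := lower_finite_quotient R hp (H1_perfect h1) hQ.
  split=> //; exists c0, c1; split=> //.
  by apply: filterS2 lr hr => n -> ->.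
- move=> h1 h2 [g gP].
  have up := upper_infinite_order R hp (H1_perfect h1) (H2_lifting h1 h2) gP.
  have [k [r [hkr hk hr]]] := up; split=> // [n|].
    by have [_ le] := min_generators_spec (hkr n); apply: leq_trans le (hk n).
  by apply: asympO_le hr => n; case: (min_relators_spec (hkr n)).
Qed.
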